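(* Let $(E,\mathcal{L},\mathcal{E})$ be a labeled space such that every quotient labeled space $(E,\mathcal{L},\mathcal{E}/R)$ satisfies the following condition: every $[A]\ne[\emptyset]$ in $\mathcal{E}/R$ contains some minimal $[B]\in(\mathcal{E}/R)_{\rm min}$, and for every $[A]\in(\mathcal{E}/R)_{\rm min}$ and every $\alpha\in\mathcal{L}_R^*(E)$ the class $r([A],\alpha)$ is a finite (possibly empty) union of elements of $(\mathcal{E}/R)_{\rm min}$. If $C^*(E,\mathcal{L},\mathcal{E})$ is purely infinite, then $(E,\mathcal{L},\mathcal{E})$ is strongly disagreeable.
   Context: **Labeled spaces.** $E=(E^0,E^1,r,s)$ is a directed graph (countable vertex set $E^0$ and edge set $E^1$, range and source maps $r,s$) with no sinks (every vertex emits an edge). A finite path of length $n\ge 1$ is $\lambda=\lambda_1\cdots\lambda_n$ with $r(\lambda_i)=s(\lambda_{i+1})$; $E^n$ is the set of these, $E^{\ge 1}=\bigcup_{n\ge1}E^n$, and $AE^n$ (resp. $E^nA$) is the set of paths in $E^n$ with source (resp. range) in $A\subset E^0$. $\mathcal{L}:E^1\to\mathcal{A}$ is an onto labeling map to a countable alphabet, extended to paths by $\mathcal{L}(\lambda_1\cdots\lambda_n)=\mathcal{L}(\lambda_1)\cdots\mathcal{L}(\lambda_n)$; $\mathcal{L}^*(E)=\mathcal{L}(E^{\ge1})$ is the set of labeled paths, and $|\alpha|$ is the length of $\alpha$. For $\alpha\in\mathcal{L}^*(E)$, $A\subset E^0$: $r(\alpha)=\{r(\lambda):\lambda\in E^{\ge1},\mathcal{L}(\lambda)=\alpha\}$,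 and the relative range is $r(A,\alpha)=\{r(\lambda):\lambda\in AE^{\ge1},\mathcal{L}(\lambda)=\alpha\}$. A collection of subsets of $E^0$ is accommodating if it contains all $r(\alpha)$ and is closed under relative ranges, finite unions and finite intersections. $\mathcal{E}$ denotes the smallest accommodating set that is also closed under relative complements. Standing assumptions on $(E,\mathcal{L},\mathcal{E})$: it is weakly left-resolving ($r(A,\alpha)\cap r(B,\alpha)=r(A\cap B,\alpha)$ for $A,B\in\mathcal{E}$, $\alpha\in\mathcal{L}^*(E)$), set-finite and receiver set-finite ($\mathcal{L}(AE^k)$ and $\mathcal{L}(E^kA)$ are finite for all $A\in\mathcal{E}$, $k\ge1$). **Generalized vertices.** $\Omega_0(E)$ is the set of vertices that are not sources (i.e. receive an edge). For $l\ge1$ and $v,w\in\Omega_0(E)$, $v\sim_l w$ means that the sets of labels of paths of length between $1$ and $l$ ending at $v$ and at $w$ coincide; $[v]_l\in\mathcal{E}$ is the $\sim_l$-class of $v$. Whenever $[v]_l$ is written, $v\in\Omega_0(E)$. **$C^*$-algebra.** $C^*(E,\mathcal{L},\mathcal{E})=C^*(s_a,p_A)$ is the universal $C^*$-algebra generated by projections $p_A$ ($A\in\mathcal{E}$) and partial isometries $s_a$ ($a\in\mathcal{A}$) with: (i) $p_\emptyset=0$, $p_{A\cap B}=p_Ap_B$, $p_{A\cup B}=p_A+p_B-p_{A\cap B}$; (ii) $p_As_a=s_ap_{r(A,a)}$; (iii) $s_a^*s_a=p_{r(a)}$ and $s_a^*s_b=0$ if $a\ne b$; (iv) $p_A=\sum_{a\in\mathcal{L}(AE^1)}s_ap_{r(A,a)}s_a^*$.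 **Quotient labeled spaces.** Let $\sim_R$ be an equivalence relation on $\mathcal{E}$, $[A]$ the class of $A$, $\mathcal{E}/R$ the set of classes, $\mathcal{L}_R^*(E)=\{\alpha\in\mathcal{L}^*(E):[r(\alpha)]\ne[\emptyset]\}$. $(E,\mathcal{L},\mathcal{E}/R)$ is a quotient labeled space if $[A]\cup[B]:=[A\cup B]$, $[A]\cap[B]:=[A\cap B]$, $[A]\setminus[B]:=[A\setminus B]$ and $r([A],\alpha):=[r(A,\alpha)]$ ($\alpha\in\mathcal{L}_R^*(E)$) are well defined, and $r([A],\alpha)=[\emptyset]$ for all $\alpha\in\mathcal{L}_R^*(E)$ implies $[A]=[\emptyset]$; it is always assumed weakly left-resolving ($r([A],\alpha)\cap r([B],\alpha)=r([A]\cap[B],\alpha)$). $[A]\subseteq[B]$ means $[A]\cap[B]=[A]$. $(\mathcal{E}/R)_{\rm min}$ is the set of $[A]\ne[\emptyset]$ such that $[A]\cap[B]\in\{[A],[\emptyset]\}$ for all $[B]\in\mathcal{E}/R$. The equality relation gives $(E,\mathcal{L},\mathcal{E})$ itself. In particular, $H\subseteq\mathcal{E}$ (with $\emptyset\in H$) is hereditary if it is closed under finite unions, relative ranges $r(\cdot,\alpha)$ ($\alpha\in\mathcal{L}^*(E)$), and subsets belonging to $\mathcal{E}$; it is saturated if $A\in H$ whenever $A\in\mathcal{E}$ and $r(A,\alpha)\in H$ for all $\alpha\in\mathcal{L}^*(E)$. Such $H$ gives a quotient labeled space $(E,\mathcal{L},\mathcal{E}/H)$ via $A\sim_H B\iff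 A\cup W=B\cup W$ for some $W\in H$. **Strongly disagreeable.** For $[[v]_l]\ne[\emptyset]$ in $\mathcal{E}/R$, a path $\alpha\in\mathcal{L}_R^*(E)$ is disagreeable for $[[v]_l]$ if $[r([v]_l,\alpha)]\neq[\emptyset]$ and $\alpha$ cannot be written as $\alpha=\beta\alpha'=\alpha'\gamma$ with $\alpha',\beta,\gamma\in\mathcal{L}_R^*(E)$, $|\beta|=|\gamma|\le l$. The class $[[v]_l]$ is disagreeable if there is $N\ge1$ such that for all $n>N$ there is a path of length $\ge n$ disagreeable for $[[v]_l]$. $(E,\mathcal{L},\mathcal{E}/R)$ is disagreeable if every $[[v]_l]\ne[\emptyset]$, $l\ge1$, is disagreeable. $(E,\mathcal{L},\mathcal{E})$ is strongly disagreeable if $(E,\mathcal{L},\mathcal{E}/H)$ is disagreeable for every hereditary saturated $H\subseteq\mathcal{E}$ (including $H=\{\emptyset\}$). **Purely infinite.** For positive $a,b$ in a $C^*$-algebra $D$, $a\precsim b$ means $x_k^*bx_k\to a$ for some sequence $x_k\in D$. $D$ is purely infinite (in the sense of Kirchberg and R\o rdam) if it has no characters and for all positive $a,b\in D$: $a\precsim b$ iff $a\in\overline{DbD}$ (closed ideal generated by $b$). *)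

(* Defs.v *)
From HB Require Import structures.
From mathcomp Require Import all_boot all_order all_algebra.
From mathcomp Require Import complex.
From mathcomp Require Import all_classical all_reals all_analysis.
Set Implicit Arguments.
Unset Strict Implicit.
Unset Printing Implicit Defensive.
Import Order.TTheory GRing.Theory Num.Theory.
Import numFieldNormedType.Exports.
Local Open Scope classical_set_scope.
Local Open Scope ring_scope.
Local Open Scope complex_scope.

(* The library has no structure for rings without unit, so the product is a
   field of the record; the norm of a normed module over R[i] is R[i]-valued. *)
Record cstar_algebra (R : realType) := CStarAlgebra {
  cstar_sort :> completeNormedModType R[i];
  cmul : cstar_sort -> cstar_sort -> cstar_sort;
  adj : cstar_sort -> cstar_sort;
  cmulA : forall x y z, cmul x (cmul y z) = cmul (cmul x y) z;
  cmulDl : forall x y z, cmul (x + y) z = cmul x z + cmul y z;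
  cmulDr : forall x y z, cmul x (y + z) = cmul x y + cmul x z;
  cmulZl : forall (c : R[i]) x y, cmul (c *: x) y = c *: cmul x y;
  cmulZr : forall (c : R[i]) x y, cmul x (c *: y) = c *: cmul x y;
  adjK : forall x, adj (adj x) = x;
  adjD : forall x y, adj (x + y) = adj x + adj y;
  adjZ : forall (c : R[i]) x, adj (c *: x) = Num.conj c *: adj x;
  adjM : forall x y, adj (cmul x y) = cmul (adj y) (adj x);
  cnormM : forall x y, `|cmul x y| <= `|x| * `|y|;
  cnorm_adj : forall x, `|cmul (adj x) x| = `|x| ^+ 2
}.

Notation "x ** y" := (cmul x y) (at level 40, left associativity) : ring_scope.

Section CStar.
Variables (R : realType) (D : cstar_algebra R).
Implicit Types (a b x y : D) (S : set D).

Definition is_projection x := adj x = x /\ x ** x = x.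

Definition is_partial_isometry x := x ** adj x ** x = x.

Definition cpositive x := exists y, x = adj y ** y.

Definition is_star_hom (B : cstar_algebra R) (f : D -> B) :=
  [/\ forall x y, f (x + y) = f x + f y,
      forall (c : R[i]) x, f (c *: x) = c *: f x,
      forall x y, f (x ** y) = f x ** f y
    & forall x, f (adj x) = adj (f x)].

Definition is_character (f : D -> R[i]) :=
  [/\ forall x y, f (x + y) = f x + f y,
      forall (c : R[i]) x, f (c *: x) = c * f x,
      forall x y, f (x ** y) = f x * f y
    & exists x, f x != 0].

Definition closed_subspace S :=
  [/\ closed S, S 0, forall x y, S x -> S y -> S (x + y)
    & forall (c : R[i]) x, S x -> S (c *: x)].

Definition closed_star_subalgebra S :=
  [/\ closed_subspace S, forall x y, S x -> S y -> S (x ** y)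
    & forall x, S x -> S (adj x)].

Definition closed_ideal S :=
  closed_subspace S /\ forall x y, S x -> S (x ** y) /\ S (y ** x).

Definition closed_ideal_gen b : set D := smallest closed_ideal [set b].

Definition cuntz_sub a b :=
  exists x : nat -> D, adj (x k) ** b ** x k @[k --> \oo] --> a.

Definition purely_infinite :=
  (~ exists f, is_character f) /\
  forall a b, cpositive a -> cpositive b ->
    (cuntz_sub a b <-> closed_ideal_gen b a).

End CStar.

Record labeled_graph := LabeledGraph {
  vertex : countType;
  edge : countType;
  letter : countType;
  src : edge -> vertex;
  tgt : edge -> vertex;
  lab : edge -> letter;
  no_sinks : forall v, exists e, src e = v;
  lab_onto : forall a, exists e, lab e = a
}.

Section LabeledSpace.
Variable G : labeled_graph.
Implicit Types (A B W : set (vertex G)) (al be ga : seq (letter G)).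
Implicit Types (v w : vertex G) (H C : set (set (vertex G))).

Definition follows (e f : edge G) := tgt e == src f.

(* The path e p_1 ... p_m is represented by its first edge e and its tail p. *)
Definition is_path (e : edge G) (p : seq (edge G)) : bool := path follows e p.

Definition path_label (e : edge G) (p : seq (edge G)) := map (@lab G) (e :: p).

Definition labeled_path al := exists e p, is_path e p /\ path_label e p = al.

Definition range_of al : set (vertex G) :=
  [set v | exists e p, [/\ is_path e p, path_label e p = al
                         & tgt (last e p) = v]].

Definition rel_range A al : set (vertex G) :=
  [set v | exists e p, [/\ is_path e p, A (src e), path_label e p = al
                         & tgt (last e p) = v]].

(* Finite unions include the empty one; the field acc0 only matters when the
   graph has no vertex. *)
Record accommodating C : Prop := Accommodating {
  acc0 : C set0;
  acc_range : forall al, labeled_path al -> C (range_of al);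
  acc_rel_range : forall A al, C A -> labeled_path al -> C (rel_range A al);
  accU : forall A B, C A -> C B -> C (A `|` B);
  accI : forall A B, C A -> C B -> C (A `&` B)
}.

Definition calE : set (set (vertex G)) :=
  smallest (fun C => accommodating C /\
                     forall A B, C A -> C B -> C (A `\` B)) set0.

Definition labels_from A k : set (seq (letter G)) :=
  [set al | exists e p, [/\ is_path e p, size (e :: p) = k, A (src e)
                          & path_label e p = al]].

Definition labels_into A k : set (seq (letter G)) :=
  [set al | exists e p, [/\ is_path e p, size (e :: p) = k, A (tgt (last e p))
                          & path_label e p = al]].

Record labeled_space : Prop := LabeledSpace {
  weakly_left_resolving : forall A B al, calE A -> calE B -> labeled_path al ->
    rel_range A al `&` rel_range B al = rel_range (A `&` B) al;
  set_finite : forall A k, calE A -> (1 <= k)%N -> finite_set (labels_from A k);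
  receiver_set_finite : forall A k, calE A -> (1 <= k)%N ->
    finite_set (labels_into A k)
}.

Definition non_source v := exists e : edge G, tgt e = v.

Definition labels_to l v : set (seq (letter G)) :=
  [set al | exists e p, [/\ is_path e p, (1 <= size (e :: p) <= l)%N,
                            tgt (last e p) = v & path_label e p = al]].

Definition gen_vertex l v : set (vertex G) :=
  [set w | non_source w /\ labels_to l w = labels_to l v].

(* A relation on calE is given by a relation Q on all sets of vertices of which
   only the restriction to calE is used; [A] = [B] is written Q A B. *)
Section Quotient.
Variable Q : set (vertex G) -> set (vertex G) -> Prop.

Definition q_labeled_path al := labeled_path al /\ ~ Q (range_of al) set0.

Record quotient_labeled_space : Prop := QuotientLabeledSpace {
  q_refl : forall A, calE A -> Q A A;
  q_sym : forall A B, calE A -> calE B -> Q A B -> Q B A;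
  q_trans : forall A B W, calE A -> calE B -> calE W ->
    Q A B -> Q B W -> Q A W;
  qU : forall A A' B B', calE A -> calE A' -> calE B -> calE B' ->
    Q A A' -> Q B B' -> Q (A `|` B) (A' `|` B');
  qI : forall A A' B B', calE A -> calE A' -> calE B -> calE B' ->
    Q A A' -> Q B B' -> Q (A `&` B) (A' `&` B');
  qD : forall A A' B B', calE A -> calE A' -> calE B -> calE B' ->
    Q A A' -> Q B B' -> Q (A `\` B) (A' `\` B');
  q_rel_range : forall A A' al, calE A -> calE A' -> q_labeled_path al ->
    Q A A' -> Q (rel_range A al) (rel_range A' al);
  q_nondegenerate : forall A, calE A ->
    (forall al, q_labeled_path al -> Q (rel_range A al) set0) -> Q A set0;
  q_weakly_left_resolving : forall A B al, calE A -> calE B ->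
    q_labeled_path al ->
    Q (rel_range A al `&` rel_range B al) (rel_range (A `&` B) al)
}.

Definition q_sub A B := Q (A `&` B) A.

Definition q_minimal A :=
  [/\ calE A, ~ Q A set0
    & forall B, calE B -> Q (A `&` B) A \/ Q (A `&` B) set0].

Definition has_minimal_structure :=
  (forall A, calE A -> ~ Q A set0 -> exists B, q_minimal B /\ q_sub B A) /\
  (forall A al, q_minimal A -> q_labeled_path al ->
    exists Bs : seq (set (vertex G)), (forall i, (i < size Bs)%N ->
        q_minimal (nth set0 Bs i)) /\
      Q (rel_range A al) (\big[setU/set0]_(B <- Bs) B)).

Definition disagreeable_path l v al :=
  [/\ q_labeled_path al, ~ Q (rel_range (gen_vertex l v) al) set0
    & ~ exists be al' ga,
        [/\ q_labeled_path al', q_labeled_path be, q_labeled_path ga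
          & [/\ al = be ++ al', al = al' ++ ga, size be = size ga
              & (size be <= l)%N]]].

Definition disagreeable_class l v :=
  exists2 N, (1 <= N)%N & forall n, (N < n)%N ->
    exists2 al, (n <= size al)%N & disagreeable_path l v al.

Definition disagreeable :=
  forall l v, (1 <= l)%N -> non_source v -> ~ Q (gen_vertex l v) set0 ->
    disagreeable_class l v.

End Quotient.

Record hereditary H : Prop := Hereditary {
  her_sub : H `<=` calE;
  her0 : H set0;
  herU : forall A B, H A -> H B -> H (A `|` B);
  her_rel_range : forall A al, H A -> labeled_path al -> H (rel_range A al);
  her_subset : forall A B, H A -> calE B -> B `<=` A -> H B
}.

Definition saturated H := forall A, calE A ->
  (forall al, labeled_path al -> H (rel_range A al)) -> H A.

Definition ideal_rel H A B := exists2 W, H W & A `|` W = B `|` W.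

Definition strongly_disagreeable :=
  forall H, hereditary H -> saturated H -> disagreeable (ideal_rel H).

Section Representations.
Variable R : realType.

Definition letters_from A : set (letter G) :=
  [set a | exists2 e : edge G, A (src e) & lab e = a].

(* The values of p outside calE are irrelevant.  The sum in rep_sum is over a
   finite set when the labeled space is set-finite. *)
Record representation (D : cstar_algebra R) (s : letter G -> D)
    (p : set (vertex G) -> D) : Prop := Representation {
  rep_proj : forall A, calE A -> is_projection (p A);
  rep_pisom : forall a, is_partial_isometry (s a);
  rep0 : p set0 = 0;
  repI : forall A B, calE A -> calE B -> p (A `&` B) = p A ** p B;
  repU : forall A B, calE A -> calE B ->
    p (A `|` B) = p A + p B - p (A `&` B);
  rep_comm : forall A a, calE A -> p A ** s a = s a ** p (rel_range A [:: a]);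
  rep_source : forall a, adj (s a) ** s a = p (range_of [:: a]);
  rep_orth : forall a b, a <> b -> adj (s a) ** s b = 0;
  rep_sum : forall A, calE A ->
    p A = \sum_(a \in letters_from A)
            (s a ** p (rel_range A [:: a]) ** adj (s a))
}.

(* C*(E, L, calE) = C*(s_a, p_A), characterized up to isomorphism. *)
Definition universal_representation (D : cstar_algebra R) (s : letter G -> D)
    (p : set (vertex G) -> D) :=
  [/\ representation s p,
      smallest (@closed_star_subalgebra R D)
        ([set s a | a in setT] `|` [set p A | A in calE]) = setT
    & forall (B : cstar_algebra R) (t : letter G -> B)
        (q : set (vertex G) -> B), representation t q ->
        exists f : D -> B, [/\ is_star_hom f, forall a, f (s a) = t a
                             & forall A, calE A -> f (p A) = q A]].

End Representations.
End LabeledSpace.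

(* Main.v *)
Require Import Defs.
From HB Require Import structures.
From mathcomp Require Import all_boot all_order all_algebra.
From mathcomp Require Import complex.
From mathcomp Require Import all_classical all_reals all_analysis.
From mathcomp Require Import ring lra.
Set Implicit Arguments.
Unset Strict Implicit.
Unset Printing Implicit Defensive.
Import Order.TTheory GRing.Theory Num.Theory.
Import numFieldNormedType.Exports.
Local Open Scope classical_set_scope.
Local Open Scope ring_scope.
Local Open Scope complex_scope.

(** Suppose that, modulo a hereditary saturated H, the class of some [v]_l is
    nonzero and not disagreeable. Then all long words emitted by [v]_l modulo H
    have a period at most l, hence the period l`!. Following minimal sets of the
    quotient for l`! steps leads from below [v]_l to a minimal set A that can
    emit a single infinite word, which is periodic: see [unique_word].

    The C*-algebra acts on infinite words decorated with compatible prime filters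
    of calE avoiding H. The projection of B selects the points whose first filter
    contains B, and the partial isometry of a letter prepends it. A set of points
    sharing their tails is invariant, so this gives a representation on the
    square-summable sequences: see [orbit_representation]. Prime filters are
    pulled back uniquely along letters, and all points over A read the same
    periodic word. Hence two points over A with a common tail coincide unless the
    tails are shifted, which requires a return to A; going for ever round a
    shortest return then yields a point that is alone over A in its orbit: see
    [isolated_point]. So the universal property provides a *-homomorphism f into
    bounded operators for which f (p A) is a projection of rank one.

    Such a homomorphism excludes pure infiniteness, by
    [rank_one_not_purely_infinite]. Let phi be the vector state of f at a unit
    vector of the range of f (p A). Rank one means that
    phi (x ** p A ** y) = phi x * phi y. If phi is multiplicative, it is a
    character. If not, some z = z ** p A has phi z = 0 and
    phi (adj z ** z) <> 0. The square of p A + z ** adj z is in the closed ideal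
    generated by p A, but it is not a limit of elements adj x ** p A ** x: these
    are mapped to operators of rank at most one, whereas a 2 x 2 Gram determinant
    shows that the square has larger rank. The limit is legitimate because phi is
    bounded, which follows from its positivity and from square roots of 1 - h for
    small self-adjoint h, obtained by a fixed point iteration.

    On Hilbert spaces the inner product is taken to be the real part of the usual
    one. It determines adjoints and norms, and on square-summable sequences its
    convergence follows from that of monotone bounded sums by polarization. *)

(** * Hilbert spaces over the complex numbers *)

(** The inner product is the real part of the usual one, which determines
    adjoints and norms. That scalars move across it with a conjugation is what
    remains of sesquilinearity. *)
Record hilbert (R : realType) := Hilbert {
  hilbert_sort :> lmodType R[i];
  rip : hilbert_sort -> hilbert_sort -> R;
  ripC : forall u v, rip u v = rip v u;
  ripDl : forall u v w, rip (u + v) w = rip u w + rip v w;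
  ripZ : forall (r : R) u v, rip (r%:C *: u) v = r * rip u v;
  ripJ : forall (c : R[i]) u v, rip (c *: u) v = rip u (Num.conj c *: v);
  rip_ge0 : forall u, 0 <= rip u u;
  rip_eq0 : forall u, rip u u = 0 -> u = 0;
  hcomplete : forall u : nat -> hilbert_sort,
    (forall e, 0 < e -> exists N, forall m n, (N <= m)%N -> (N <= n)%N ->
      Num.sqrt (rip (u m - u n) (u m - u n)) <= e) ->
    exists l, forall e, 0 < e -> exists N, forall n, (N <= n)%N ->
      Num.sqrt (rip (u n - l) (u n - l)) <= e
}.

Section HilbertTheory.
Variables (R : realType) (H : hilbert R).
Implicit Types (u v w : H) (r : R).

Lemma absc_ge0 (c : R[i]) : 0 <= complex.Re `|c|.
Proof. by case: c => a b; rewrite normc_def /= sqrtr_ge0. Qed.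

Definition hnorm u : R := Num.sqrt (rip u u).

Lemma ripDr u v w : rip u (v + w) = rip u v + rip u w.
Proof. by rewrite ripC ripDl ![rip _ u]ripC. Qed.

Lemma rip0l v : rip 0 v = 0.
Proof. by apply: (@addIr _ (rip 0 v)); rewrite -ripDl !add0r. Qed.

Lemma ripNl u v : rip (- u) v = - rip u v.
Proof. by apply/eqP; rewrite -addr_eq0 -ripDl addNr rip0l. Qed.

Lemma ripBl u v w : rip (u - v) w = rip u w - rip v w.
Proof. by rewrite ripDl ripNl. Qed.

Lemma ripZr r u v : rip u (r%:C *: v) = r * rip u v.
Proof. by rewrite ripC ripZ ripC. Qed.

Lemma rip_inj u v : (forall w, rip u w = rip v w) -> u = v.
Proof.
by move=> uv; apply/eqP; rewrite -subr_eq0; apply/eqP/rip_eq0;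
  rewrite ripBl uv subrr.
Qed.

Lemma hnorm_ge0 u : 0 <= hnorm u. Proof. exact: sqrtr_ge0. Qed.

Lemma hnormE u : hnorm u ^+ 2 = rip u u.
Proof. exact/sqr_sqrtr/rip_ge0. Qed.

Lemma hnorm0 : hnorm 0 = 0. Proof. by rewrite /hnorm rip0l sqrtr0. Qed.

Lemma hnorm_eq0 u : hnorm u = 0 -> u = 0.
Proof. by move=> u0; apply: rip_eq0; rewrite -hnormE u0 expr0n. Qed.

(** Cauchy-Schwarz inequality: expand the square of the norm of
    |v| u - |u| v. *)
Lemma rip_le u v : rip u v <= hnorm u * hnorm v.
Proof.
have [v0|/eqP v0] := eqVneq (hnorm v) 0.
  by rewrite (hnorm_eq0 v0) ripC rip0l hnorm0 mulr0.
have vp : 0 < hnorm v by rewrite lt_def hnorm_ge0 andbT; apply/eqP.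
have [u0|/eqP u0] := eqVneq (hnorm u) 0.
  by rewrite (hnorm_eq0 u0) rip0l hnorm0 mul0r.
have up : 0 < hnorm u by rewrite lt_def hnorm_ge0 andbT; apply/eqP.
have := rip_ge0 ((hnorm v)%:C *: u + (- hnorm u)%:C *: v).
rewrite ripDl !ripDr !(ripZ, ripZr) [rip v u]ripC -!hnormE => h.
have {}h : 0 <= (2 * hnorm u * hnorm v) * (hnorm u * hnorm v - rip u v) by lra.
by rewrite -subr_ge0 -(pmulr_rge0 _ (_ : 0 < 2 * hnorm u * hnorm v))//
  !mulr_gt0.
Qed.

Lemma hnormD u v : hnorm (u + v) <= hnorm u + hnorm v.
Proof.
rewrite -(@ler_pXn2r _ 2%N) ?nnegrE ?hnorm_ge0 ?addr_ge0 ?hnorm_ge0//.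
rewrite hnormE ripDl !ripDr [rip v u]ripC sqrrD !hnormE.
have := rip_le u v; lra.
Qed.

Lemma hnormZ (c : R[i]) u : hnorm (c *: u) = complex.Re `|c| * hnorm u.
Proof.
have cE : Num.conj c * c = (complex.Re `|c| ^+ 2)%:C.
  rewrite mulrC -normCK; case: c => a b; rewrite normc_def /=.
  by rewrite -rmorphXn.
rewrite /hnorm ripJ scalerA cE ripZr sqrtrM ?sqr_ge0// sqrtr_sqr ger0_norm//.
exact: absc_ge0.
Qed.

Lemma hnormN u : hnorm (- u) = hnorm u.
Proof. by rewrite /hnorm ripNl ripC ripNl opprK. Qed.

End HilbertTheory.

(** * The normed space of bounded operators *)

Section Operators.
Variables (R : realType) (H : hilbert R).
Implicit Types (u v w : H) (r K : R) (T S : H -> H).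

Definition op_bound T K := 0 <= K /\ forall u, hnorm (T u) <= K * hnorm u.

Definition adjoint_to T S := forall u v, rip (T u) v = rip u (S v).

Definition linear_map T := forall (c : R[i]) u v, T (c *: u + v) = c *:
  T u + T v.

Lemma linear_map0 T : linear_map T -> T 0 = 0.
Proof.
move=> lT; have := lT 1 0 0.
by rewrite !scale1r addr0 -[X in X = _]addr0 => /addrI <-.
Qed.

Lemma linear_mapZ T c u : linear_map T -> T (c *: u) = c *: T u.
Proof. by move=> lT; rewrite -[c *: u]addr0 lT (linear_map0 lT) addr0. Qed.

(** Bounded linear maps with an adjoint. The maps themselves are the carrier, so
    that products are compositions; adjoints are recovered by choice. *)
Definition is_op T := `[< [/\ linear_map T, exists K, op_bound T K
                            & exists S, adjoint_to T S] >].

Lemma is_op_submod : submod_closed is_op.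
Proof.
split.
  apply/asboolP; split.
  - by move=> c u v /=; rewrite scaler0 addr0.
  - by exists 0; split=> // u; rewrite hnorm0 mul0r.
  - by exists (fun=> 0) => u v; rewrite rip0l ripC rip0l.
move=> c T T' /asboolP[lT [K [K0 TK]] [S TS]]
  /asboolP[lT' [K' [K0' TK']] [S' TS']].
apply/asboolP; split.
- move=> d u v; rewrite !fctE lT lT' !scalerDr !scalerA [d * c]mulrC.
  by rewrite -!addrA; congr (_ + _); rewrite addrCA.
- have c0 := absc_ge0 c.
  exists (complex.Re `|c| * K + K'); split=> [|u].
    by rewrite addr_ge0// mulr_ge0.
  rewrite (le_trans (hnormD _ _))// mulrDl lerD//.
  by rewrite [leLHS]hnormZ -mulrA ler_wpM2l.
- exists (fun v => Num.conj c *: S v + S' v) => u v.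
  rewrite (_ : (c *: T + T') u = c *: T u + T' u)// ripDl.
  by rewrite -(linear_mapZ _ _ lT) TS TS' ripJ ripDr.
Qed.

HB.instance Definition _ := GRing.isSubmodClosed.Build R[i] (H -> H)%type is_op
  is_op_submod.

Record op := Op { opf :> H -> H; _ : opf \in is_op }.
HB.instance Definition _ := [isSub for opf].
HB.instance Definition _ := [Choice of op by <:].
HB.instance Definition _ := [SubChoice_isSubLmodule of op by <:].

Implicit Types (x y z : op).

Lemma opP x : [/\ linear_map x, exists K, op_bound x K
                 & exists S, adjoint_to x S].
Proof. by case: x => T /= /asboolP. Qed.

Lemma op_eq x y : (forall u, x u = y u) -> x = y.
Proof. by move=> xy; apply/val_inj/funext. Qed.

Lemma opDE x y u : (x + y) u = x u + y u. Proof. by []. Qed.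
Lemma opBE x y u : (x - y) u = x u - y u. Proof. by []. Qed.
Lemma opZE c x u : (c *: x) u = c *: x u. Proof. by []. Qed.

Lemma op_lin x : linear_map x. Proof. by have [] := opP x. Qed.
Lemma op_0 x : x 0 = 0. Proof. exact/linear_map0/op_lin. Qed.
Lemma op_Z x c u : x (c *: u) = c *: x u. Proof. exact/linear_mapZ/op_lin. Qed.
Lemma op_D x u v : x (u + v) = x u + x v.
Proof. by rewrite -[u]scale1r op_lin !scale1r. Qed.

Definition opn x : R := inf [set K | op_bound x K].

Lemma opn_has_inf x : has_inf [set K | op_bound x K].
Proof.
have [_ [K xK] _] := opP x; split; first by exists K.
by exists 0 => r [].
Qed.

Lemma opn_ge0 x : 0 <= opn x.
Proof. by apply: lb_le_inf; [case: (opn_has_inf x)|move=> r []]. Qed.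

Lemma opn_le x K : op_bound x K -> opn x <= K.
Proof. by move=> xK; apply: ge_inf => //; case: (opn_has_inf x). Qed.

(** The infimum of the bounds is itself a bound. *)
Lemma opn_bound x : op_bound x (opn x).
Proof.
split=> [|u]; first exact: opn_ge0.
have [u0|/eqP u0] := eqVneq (hnorm u) 0.
  by rewrite (hnorm_eq0 u0) op_0 hnorm0 mulr0.
have up : 0 < hnorm u by rewrite lt_def hnorm_ge0 andbT; apply/eqP.
rewrite -ler_pdivrMr//; apply: lb_le_inf; first by case: (opn_has_inf x).
by move=> K [K0 xK]; rewrite ler_pdivrMr.
Qed.

Lemma opnP x u : hnorm (x u) <= opn x * hnorm u.
Proof. by have [_] := opn_bound x. Qed.

Lemma opnD x y : opn (x + y) <= opn x + opn y.
Proof.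
apply: opn_le; split=> [|u]; first by rewrite addr_ge0 ?opn_ge0.
by rewrite (le_trans (hnormD _ _))// mulrDl lerD// opnP.
Qed.

Lemma opnZ_le (c : R[i]) x : opn (c *: x) <= complex.Re `|c| * opn x.
Proof.
have c0 := absc_ge0 c.
apply: opn_le; split=> [|u]; first by rewrite mulr_ge0 ?opn_ge0.
by rewrite opZE hnormZ -mulrA ler_wpM2l// opnP.
Qed.

Lemma opn0 : opn 0 = 0.
Proof.
by apply/le_anti; rewrite opn_ge0 andbT -(scale0r (0 : op))
  (le_trans (opnZ_le _ _))// normr0 mul0r.
Qed.

Lemma opnZ (c : R[i]) x : opn (c *: x) = complex.Re `|c| * opn x.
Proof.
have [->|c0] := eqVneq c 0; first by rewrite scale0r opn0 normr0 mul0r.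
apply/le_anti; rewrite opnZ_le andTb.
have := opnZ_le c^-1 (c *: x); rewrite scalerA mulVf// scale1r normfV.
have := c0; rewrite -normr_gt0; have [n ->] : exists n : R, `|c| = n%:C.
  by case: (c) => a b; rewrite normc_def; eexists.
rewrite ltcR => n0; rewrite -fmorphV /= => h.
by rewrite -ler_pdivlMl.
Qed.

Lemma opn_eq0 x : opn x = 0 -> x = 0.
Proof.
move=> x0; apply: op_eq => u; apply: hnorm_eq0; apply/le_anti.
by rewrite hnorm_ge0 andbT (le_trans (opnP _ _))// x0 mul0r.
Qed.

Definition op_norm x : R[i] := (opn x)%:C.

Fact op_normD x y : op_norm (x + y) <= op_norm x + op_norm y.
Proof. by rewrite -rmorphD lecR opnD. Qed.

Fact op_normZ (c : R[i]) x : op_norm (c *: x) = `|c| * op_norm x.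
Proof.
by rewrite /op_norm opnZ rmorphM.
Qed.

Fact op_norm_eq0 x : op_norm x = 0 -> x = 0.
Proof. by case=> /opn_eq0. Qed.

HB.instance Definition _ :=
  @Lmodule_isNormed.Build R[i] op op_norm op_normD op_normZ op_norm_eq0.

Lemma norm_opE x : `|x| = (opn x)%:C. Proof. by []. Qed.

End Operators.

(** * The C*-algebra of bounded operators *)

Section Adjoint.
Variables (R : realType) (H : hilbert R).
Implicit Types (u v w : H) (r K : R) (x y z : op H).

(** The adjoint inherits the bound of x, since the squared norm of S u is
    <x (S u), u>. *)
Lemma adjoint_is_op x S : adjoint_to x S -> S \in @is_op R H.
Proof.
move=> xS; have Sx u v : rip (S u) v = rip u (x v) by rewrite ripC -xS ripC.
apply/asboolP; split.
- move=> c u v; apply: rip_inj => w.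
  by rewrite Sx ripDl ripJ -op_Z -!Sx -ripJ -ripDl.
- exists (opn x); split=> [|u]; first exact: opn_ge0.
  have [->|/eqP Su0] := eqVneq (hnorm (S u)) 0.
    by rewrite mulr_ge0 ?opn_ge0 ?hnorm_ge0.
  have Sp : 0 < hnorm (S u) by rewrite lt_def hnorm_ge0 andbT; apply/eqP.
  rewrite -(ler_pM2r Sp) -expr2 hnormE -xS (le_trans (rip_le _ _))//.
  by rewrite mulrAC ler_wpM2r ?hnorm_ge0// opnP.
- by exists x.
Qed.

Fact op_adj_ex x : exists y : op H, adjoint_to x y.
Proof. by have [_ _ [S xS]] := opP x; exists (Op (adjoint_is_op xS)). Qed.

Definition op_adj x : op H := projT1 (cid (op_adj_ex x)).

Lemma op_adjP x u v : rip (x u) v = rip u (op_adj x v).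
Proof. by rewrite /op_adj; case: cid. Qed.

Lemma op_adjP' x u v : rip (op_adj x u) v = rip u (x v).
Proof. by rewrite ripC -op_adjP ripC. Qed.

Lemma op_adj_uniq x y : (forall u v, rip (x u) v = rip u (y v)) -> op_adj x = y.
Proof.
move=> xy; apply: op_eq => u; apply: rip_inj => w.
by rewrite op_adjP' ripC [RHS]ripC xy.
Qed.

Lemma op_adjK x : op_adj (op_adj x) = x.
Proof. by apply: op_adj_uniq => u v; rewrite op_adjP'. Qed.

Lemma op_adjD x y : op_adj (x + y) = op_adj x + op_adj y.
Proof. by apply: op_adj_uniq => u v; rewrite !opDE ripDl ripDr !op_adjP. Qed.

Lemma op_adjZ c x : op_adj (c *: x) = Num.conj c *: op_adj x.
Proof.
apply: op_adj_uniq => u v.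
by rewrite !opZE -op_Z op_adjP ripJ.
Qed.

Lemma op_adjB x y : op_adj (x - y) = op_adj x - op_adj y.
Proof. by rewrite op_adjD -scaleN1r op_adjZ rmorphN1 scaleN1r. Qed.

Fact op_mul_subproof x y : (x \o y) \in @is_op R H.
Proof.
apply/asboolP; split.
- by move=> c u v /=; rewrite !op_lin.
- exists (opn x * opn y); split=> [|u /=]; first by rewrite mulr_ge0 ?opn_ge0.
  by rewrite (le_trans (opnP _ _))// -mulrA ler_wpM2l ?opn_ge0 ?opnP.
- by exists (op_adj y \o op_adj x) => u v /=; rewrite !op_adjP.
Qed.
Definition op_mul x y : op H := Op (op_mul_subproof x y).

Lemma op_mulE x y u : op_mul x y u = x (y u). Proof. by []. Qed.

Lemma op_adjM x y : op_adj (op_mul x y) = op_mul (op_adj y) (op_adj x).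
Proof. by apply: op_adj_uniq => u v; rewrite !op_mulE !op_adjP. Qed.

Lemma opnM x y : opn (op_mul x y) <= opn x * opn y.
Proof.
apply: opn_le; split=> [|u]; first by rewrite mulr_ge0 ?opn_ge0.
by rewrite op_mulE (le_trans (opnP _ _))// -mulrA ler_wpM2l ?opn_ge0 ?opnP.
Qed.

(** The nontrivial half of the C*-identity: the squared norm of x u is
    <x* x u, u>. *)
Lemma opn_sqr_le x : opn x ^+ 2 <= opn (op_mul (op_adj x) x).
Proof.
set K := opn (op_mul _ _); have K0 : 0 <= K := opn_ge0 _.
rewrite -(sqr_sqrtr K0) ler_pXn2r ?nnegrE ?opn_ge0 ?sqrtr_ge0//.
apply: opn_le; split=> [|u]; first exact: sqrtr_ge0.
rewrite -(@ler_pXn2r _ 2%N) ?nnegrE ?mulr_ge0 ?sqrtr_ge0 ?hnorm_ge0//.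
rewrite exprMn (sqr_sqrtr K0) hnormE op_adjP ripC (le_trans (rip_le _ _))//.
by rewrite expr2 mulrA ler_wpM2r ?hnorm_ge0//;
  exact: (opnP (op_mul (op_adj x) x)).
Qed.

Lemma opn_adj_le x : opn x <= opn (op_adj x).
Proof.
have [x0|/eqP x0] := eqVneq (opn x) 0; first by rewrite x0 opn_ge0.
have xp : 0 < opn x by rewrite lt_def opn_ge0 andbT; apply/eqP.
by rewrite -(ler_pM2r xp) -expr2 (le_trans (opn_sqr_le x)) ?opnM.
Qed.

Lemma opn_adj x : opn (op_adj x) = opn x.
Proof.
by apply/le_anti; rewrite opn_adj_le andbT -{2}(op_adjK x) opn_adj_le.
Qed.

Lemma opn_cstar x : opn (op_mul (op_adj x) x) = opn x ^+ 2.
Proof.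
by apply/le_anti; rewrite opn_sqr_le andbT expr2 -{1}(opn_adj x) opnM.
Qed.

Lemma opnN x : opn (- x) = opn x.
Proof. by rewrite -scaleN1r opnZ normrN1 mul1r. Qed.

Lemma hnorm_small u : (forall e, 0 < e -> hnorm u <= e) -> u = 0.
Proof.
move=> ue; apply: hnorm_eq0; apply/le_anti; rewrite hnorm_ge0 andbT.
by apply/ler_addgt0Pr => e e0; rewrite add0r ue.
Qed.

Lemma small_mul (K e : R) : 0 <= K -> 0 < e ->
  exists2 d, 0 < d & d * K <= e.
Proof.
move=> K0 e0; exists (e / (K + 1)); first by rewrite divr_gt0// ltr_wpDl.
by rewrite -mulrA ler_piMr ?(ltW e0)// mulrC ler_pdivrMr ?ltr_wpDl// mul1r
  lerDl.
Qed.

Definition op_cauchy (x : nat -> op H) := forall e, 0 < e -> exists N,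
  forall m n, (N <= m)%N -> (N <= n)%N -> opn (x m - x n) <= e.

(** A Cauchy sequence of operators converges uniformly on the unit ball; the
    estimate is stated for all vectors so that it needs no normalization. *)
Lemma op_pointwise_lim (x : nat -> op H) : op_cauchy x ->
  exists2 T : H -> H, linear_map T &
    forall e, 0 < e -> exists N, forall n, (N <= n)%N ->
      forall u, hnorm (x n u - T u) <= e * hnorm u.
Proof.
move=> xc.
have lim u : {l | forall e, 0 < e -> exists N, forall n, (N <= n)%N ->
    hnorm (x n u - l) <= e}.
  apply: cid; apply: hcomplete => e e0.
  have [d d0 de] := small_mul (hnorm_ge0 u) e0.
  have [N xN] := xc d d0; exists N => m n mN nN.
  rewrite -opBE (le_trans (opnP _ _))// (le_trans _ de)//.
  by rewrite ler_wpM2r ?hnorm_ge0// xN.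
pose T u := projT1 (lim u).
have Tlim e : 0 < e -> exists N, forall n, (N <= n)%N ->
    forall u, hnorm (x n u - T u) <= e * hnorm u.
  move=> e0; have [N xN] := xc e e0; exists N => n nN u.
  apply/ler_addgt0Pr => d d0; have [M xM] := projT2 (lim u) d d0.
  have h1 := xM _ (leq_maxl M N).
  have tri : hnorm (x n u - T u) <=
      hnorm ((x n - x (maxn M N)) u) + hnorm (x (maxn M N) u - T u).
    by rewrite -[x n u - T u](subrKA (x (maxn M N) u)) -opBE hnormD.
  apply: (le_trans (le_trans tri (lerD (opnP _ u) h1))).
  by rewrite lerD2r ler_wpM2r ?hnorm_ge0// xN// leq_maxr.
exists T => // c u v; apply/eqP; rewrite -subr_eq0; apply/eqP.
apply: hnorm_small => e e0.
pose K := hnorm (c *: u + v) + (complex.Re `|c| * hnorm u + hnorm v).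
have c0 := absc_ge0 c.
have K0 : 0 <= K by rewrite !addr_ge0 ?hnorm_ge0// mulr_ge0 ?hnorm_ge0.
have [d d0 de] := small_mul K0 e0.
have [N xN] := Tlim d d0; have {}xN := xN _ (leqnn N).
rewrite (le_trans _ de)// /K !mulrDr.
have -> : T (c *: u + v) - (c *: T u + T v) = -
  (x N (c *: u + v) - T (c *: u + v))
   + (c *: (x N u - T u) + (x N v - T v)).
  by rewrite op_lin scalerBr opprB [X in _ = _ + X]addrACA -opprD subrKA.
rewrite (le_trans (hnormD _ _))// lerD// ?hnormN// (le_trans (hnormD _ _))//.
by rewrite lerD// [leLHS]hnormZ mulrCA ler_wpM2l.
Qed.

(** The limit has an adjoint because the sequence of adjoints is Cauchy too. *)
Lemma op_complete (x : nat -> op H) : op_cauchy x ->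
  exists l, forall e, 0 < e -> exists N, forall n, (N <= n)%N ->
    opn (x n - l) <= e.
Proof.
move=> xc; have [T lT xT] := op_pointwise_lim xc.
have xc' : op_cauchy (fun n => op_adj (x n)).
  move=> e e0; have [N xN] := xc e e0; exists N => m n mN nN.
  by rewrite -op_adjB opn_adj xN.
have [S lS xS] := op_pointwise_lim xc'.
have TS : adjoint_to T S.
  have le u v (s : R) : s = 1 \/ s = -1 -> s * (rip (T u) v - rip u (S v)) <= 0.
    move=> s1; apply/ler_addgt0Pr => e e0; rewrite add0r.
    have K0 : 0 <= 2 * (hnorm u * hnorm v).
      by rewrite !mulr_ge0 ?hnorm_ge0.
    have [d d0 de] := small_mul K0 e0.
    have [N1 xN1] := xT d d0; have [N2 xN2] := xS d d0.
    have {xN1} h1 := xN1 _ (leq_maxl N1 N2) u.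
    have {xN2} h2 := xN2 _ (leq_maxr N1 N2) v.
    set n := maxn _ _ in h1 h2.
    have -> : rip (T u) v - rip u (S v) =
       rip u (op_adj (x n) v - S v) - rip (x n u - T u) v.
      rewrite ripBl op_adjP [rip u (_ - _)]ripC ripBl ![rip _ u]ripC; ring.
    have a1 := rip_le u (op_adj (x n) v - S v).
    have a2 := rip_le (- u) (op_adj (x n) v - S v).
    have a3 := rip_le (x n u - T u) v.
    have a4 := rip_le (- (x n u - T u)) v.
    rewrite ripNl hnormN in a2; rewrite ripNl hnormN in a4.
    have b1 := ler_wpM2l (hnorm_ge0 u) h2.
    have b2 := ler_wpM2r (hnorm_ge0 v) h1.
    case: s1 => ->; move: a1 a2 a3 a4 b1 b2 de; lra.
  move=> u v; apply/eqP; rewrite -subr_eq0; apply/eqP/le_anti.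
  have := le u v 1 (or_introl erefl); have := le u v (-1) (or_intror erefl).
  by rewrite mul1r mulN1r oppr_le0 => -> ->.
have Top : T \in @is_op R H.
  apply/asboolP; split=> //; last by exists S.
  have [N xN] := xT 1 ltr01; exists (1 + opn (x N)); split=> [|u].
    by rewrite addr_ge0 ?opn_ge0.
  have -> : T u = - (x N u - T u) + x N u by rewrite opprB subrK.
  by rewrite (le_trans (hnormD _ _))// mulrDl lerD ?opnP// hnormN xN.
exists (Op Top) => e e0; have [N xN] := xT e e0; exists N => n nN.
by apply: opn_le; split=> [|u]; [exact: ltW|exact: xN].
Qed.

(** Balls with radii 1 / (n + 1) reduce Cauchy filters to Cauchy sequences. *)
Fact op_cauchy_cvg (F : set_system (op H)) : ProperFilter F -> cauchy F ->
  cvg F.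
Proof.
move=> FF /cauchyP Fc.
pose r n : R := n.+1%:R^-1; have r0 n : 0 < r n by rewrite invr_gt0.
have rlt (e : R) : 0 < e -> exists N, forall n, (N <= n)%N -> r n < e.
  move=> e0; have [N _ h] := near_infty_natSinv_lt (PosNum e0).
  by exists N.
have Fr n : exists y : op H, F (ball y (r n)%:C) by apply: Fc; rewrite ltcR.
have [x xF] := boolp.choice Fr.
have bE y z (e : R) : ball y e%:C z -> opn (y - z) < e.
  by rewrite -ball_normE /= norm_opE ltcR.
have xc : op_cauchy x.
  move=> e e0; have [N rN] := rlt (e / 2) (divr_gt0 e0 (ltr0Sn R 1)).
  exists N => m n mN nN.
  have [y [my ny]] := filter_ex (filterI (xF m) (xF n)).
  have -> : x m - x n = (x m - y) + - (x n - y) by rewrite opprB addrA subrK.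
  rewrite (le_trans (opnD _ _))// opnN.
  rewrite [leRHS]splitr lerD// ltW//.
    exact: lt_trans (bE _ _ _ my) (rN _ mN).
  exact: lt_trans (bE _ _ _ ny) (rN _ nN).
have [l xl] := op_complete xc; apply/cvg_ex; exists l.
apply/cvgrPdist_le => e e0.
have [e' ee' e'0] : exists2 e' : R, e = e'%:C & 0 < e'.
  by move: e0; case: e => a b; rewrite ltcE /= => /andP[/eqP -> a0]; exists a.
have [N xN] := xl (e' / 2) (divr_gt0 e'0 (ltr0Sn R 1)).
have [M rM] := rlt (e' / 2) (divr_gt0 e'0 (ltr0Sn R 1)).
apply: filterS (xF (maxn N M)) => y /bE.
have := xN _ (leq_maxl N M); have := rM _ (leq_maxr N M).
move=> h1 h2 h3; rewrite ee' norm_opE lecR.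
have -> : l - y = - (x (maxn N M) - l) + (x (maxn N M) - y).
  by rewrite opprB addrA subrK.
rewrite (le_trans (opnD _ _))// opnN; lra.
Qed.

HB.instance Definition _ := Uniform_isComplete.Build (op H) op_cauchy_cvg.

Definition op_cstar : cstar_algebra R.
Proof.
refine (@CStarAlgebra R (op H) op_mul op_adj _ _ _ _ _ op_adjK op_adjD op_adjZ
  op_adjM _ _).
- by move=> x y z; apply: op_eq.
- by move=> x y z; apply: op_eq.
- by move=> x y z; apply: op_eq => u; rewrite !(op_mulE, opDE) op_D.
- by move=> c x y; apply: op_eq.
- by move=> c x y; apply: op_eq => u; rewrite !(op_mulE, opZE) op_Z.
- by move=> x y; rewrite !norm_opE -rmorphM lecR opnM.
- by move=> x; rewrite !norm_opE opn_cstar rmorphXn.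
Defined.
End Adjoint.

(** * The Hilbert space of square-summable sequences *)

Section L2.
Variable R : realType.
Implicit Types (z w : R[i]) (u v : nat -> R[i]).

(** The real inner product of the complex plane, the real part of z times the
    conjugate of w. *)
Definition dotc z w : R := complex.Re z * complex.Re w + complex.Im z *
  complex.Im w.

Lemma dotcC z w : dotc z w = dotc w z.
Proof. by rewrite /dotc ![complex.Re z * _]mulrC ![complex.Im z * _]mulrC. Qed.
Lemma dotcDl z1 z2 w : dotc (z1 + z2) w = dotc z1 w + dotc z2 w.
Proof. case: z1 z2 => [a b] [c d]; rewrite /dotc /=; ring. Qed.
Lemma dotcJ (c z w : R[i]) : dotc (c * z) w = dotc z (Num.conj c * w).
Proof. case: c z w => [a b] [c d] [e f]; rewrite /dotc /=; ring. Qed.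
Lemma dotcZ (r : R) z w : dotc (r%:C * z) w = r * dotc z w.
Proof. case: z w => [c d] [e f]; rewrite /dotc /=; ring. Qed.
Lemma dotc_ge0 z : 0 <= dotc z z.
Proof. by rewrite /dotc addr_ge0// -expr2 sqr_ge0. Qed.
Lemma dotc_eq0 z : dotc z z = 0 -> z = 0.
Proof.
case: z => a b; rewrite /dotc /= -!expr2 => /eqP.
by rewrite paddr_eq0 ?sqr_ge0// !sqrf_eq0 => /andP[/eqP -> /eqP ->].
Qed.
(** Polarization turns convergence of inner products into convergence of
    monotone bounded sums. *)
Lemma dotc_polar z w :
  dotc z w = 4^-1 * (dotc (z + w) (z + w) - dotc (z - w) (z - w)).
Proof.
have n4 : (4 : R) != 0 by rewrite pnatr_eq0.
apply: (mulfI n4); rewrite mulVKf //.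
case: z w => [c d] [e f]; rewrite /dotc /=; ring.
Qed.
Lemma dotc0 w : dotc 0 w = 0.
Proof. by rewrite /dotc !mul0r addr0. Qed.

Definition dot_sum u v (n : nat) : R := \sum_(i < n) dotc (u i) (v i).

Lemma psum_ndecr u : nondecreasing_seq (dot_sum u u).
Proof.
by apply/nondecreasing_seqP => n; rewrite /dot_sum big_ord_recr lerDl dotc_ge0.
Qed.

Definition is_l2 u := `[< exists K, forall n, dot_sum u u n <= K >].

Lemma is_l2_submod : submod_closed is_l2.
Proof.
split; first by apply/asboolP; exists 0 => n; rewrite /dot_sum big1// => i _;
  rewrite dotc0.
move=> c u v /asboolP[K uK] /asboolP[L vL]; apply/asboolP.
exists (2 * (dotc c c * K) + 2 * L) => n.
have h1 := ler_wpM2l (dotc_ge0 c) (uK n).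
have h2 := vL n.
suff : dot_sum (c *: u + v) (c *: u + v) n <=
    2 * (dotc c c * dot_sum u u n) + 2 * dot_sum v v n by move: h1 h2; lra.
rewrite /dot_sum !mulr_sumr -big_split /=; apply: ler_sum => i _.
rewrite !fctE /GRing.scale /=; case: (u i) (v i) (c) => [a b] [d e] [f g].
rewrite /dotc /= -subr_ge0.
set p := f * a - g * b; set q := f * b + g * a.
suff -> : 2 * ((f * f + g * g) * (a * a + b * b)) + 2 * (d * d + e * e) -
  ((p + d) * (p + d) + (q + e) * (q + e)) = (p - d) ^+ 2 + (q - e) ^+ 2.
  by rewrite addr_ge0 ?sqr_ge0.
by rewrite /p /q; ring.
Qed.

HB.instance Definition _ :=
  GRing.isSubmodClosed.Build R[i] (nat -> R[i])%type is_l2 is_l2_submod.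

Record l2 := L2 { l2f :> nat -> R[i]; _ : l2f \in is_l2 }.
HB.instance Definition _ := [isSub for l2f].
HB.instance Definition _ := [Choice of l2 by <:].
HB.instance Definition _ := [SubChoice_isSubLmodule of l2 by <:].

Implicit Types (x y : l2).

Lemma l2P x : exists K, forall n, dot_sum x x n <= K.
Proof. by case: x => u /= /asboolP. Qed.
Lemma l2_eq x y : (forall i, x i = y i) -> x = y.
Proof. by move=> xy; apply/val_inj/funext. Qed.
Lemma l2DE x y i : (x + y) i = x i + y i. Proof. by []. Qed.
Lemma l2BE x y i : (x - y) i = x i - y i. Proof. by []. Qed.
Lemma l2ZE c x i : (c *: x) i = c * x i. Proof. by []. Qed.

Definition lrip x y : R := limn (dot_sum x y).

Lemma psum_cvg_sqr x : dot_sum x x @ \oo --> lrip x x.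
Proof.
apply: nondecreasing_is_cvgn; first exact: psum_ndecr.
by have [K xK] := l2P x; exists K => _ [n _ <-].
Qed.

Lemma psum_polar_cvg x y : dot_sum x y @ \oo -->
  4^-1 * (lrip (x + y) (x + y) - lrip (x - y) (x - y)).
Proof.
have -> : dot_sum x y = fun n =>
    4^-1 * (dot_sum (x + y) (x + y) n - dot_sum (x - y) (x - y) n).
  apply/funext => n; rewrite /dot_sum -sumrB mulr_sumr; apply: eq_bigr => i _.
  exact: dotc_polar.
by apply: cvgMr; apply: cvgB; exact: psum_cvg_sqr.
Qed.

Lemma lrip_polar x y :
  lrip x y = 4^-1 * (lrip (x + y) (x + y) - lrip (x - y) (x - y)).
Proof. by apply: cvg_lim => //; exact: psum_polar_cvg. Qed.

Lemma psum_cvg x y : dot_sum x y @ \oo --> lrip x y.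
Proof. by rewrite lrip_polar; exact: psum_polar_cvg. Qed.

Lemma lrip_unique x y l : dot_sum x y @ \oo --> l -> lrip x y = l.
Proof. exact: cvg_lim. Qed.

Fact lripC x y : lrip x y = lrip y x.
Proof.
by rewrite /lrip; congr (limn _); apply/funext => n;
  apply: eq_bigr => i _; rewrite dotcC.
Qed.

Fact lripDl x y (z : l2) : lrip (x + y) z = lrip x z + lrip y z.
Proof.
apply: lrip_unique; have -> : dot_sum (x + y) z = dot_sum x z \+ dot_sum y z.
  apply/funext => n; rewrite /dot_sum /= -big_split; apply: eq_bigr => i _.
  exact: dotcDl.
by apply: cvgD; exact: psum_cvg.
Qed.

Fact lripZ (r : R) x y : lrip (r%:C *: x) y = r * lrip x y.
Proof.
apply: lrip_unique; have -> : dot_sum (r%:C *: x) y = fun n =>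
  r * dot_sum x y n.
  apply/funext => n; rewrite /dot_sum mulr_sumr; apply: eq_bigr => i _.
  exact: dotcZ.
by apply: cvgMr; exact: psum_cvg.
Qed.

Fact lripJ (c : R[i]) x y : lrip (c *: x) y = lrip x (Num.conj c *: y).
Proof.
by rewrite /lrip; congr (limn _); apply/funext => n;
  apply: eq_bigr => i _; rewrite !l2ZE dotcJ.
Qed.

Lemma psum_le_lrip x n : dot_sum x x n <= lrip x x.
Proof.
apply: nondecreasing_cvgn_le; first exact: psum_ndecr.
exact: psum_cvg_sqr.
Qed.

Lemma lrip_le x K : (forall n, dot_sum x x n <= K) -> lrip x x <= K.
Proof.
by move=> xK; apply: limr_le; [exact: psum_cvg_sqr|apply: nearW].
Qed.

Fact lrip_ge0 x : 0 <= lrip x x.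
Proof. by apply: le_trans (psum_le_lrip x 0); rewrite /dot_sum big_ord0. Qed.

Lemma coord_le_lrip x i : dotc (x i) (x i) <= lrip x x.
Proof.
apply: le_trans (psum_le_lrip x i.+1); rewrite /dot_sum big_ord_recr lerDr.
by apply: sumr_ge0 => j _; exact: dotc_ge0.
Qed.

Fact lrip_eq0 x : lrip x x = 0 -> x = 0.
Proof.
move=> x0; apply: l2_eq => i; apply/dotc_eq0/le_anti.
by rewrite dotc_ge0 -x0 coord_le_lrip.
Qed.

Lemma real_cauchy_cvg (a : nat -> R) :
  (forall e, 0 < e -> exists N, forall m n, (N <= m)%N -> (N <= n)%N ->
    `|a m - a n| <= e) -> cvgn a.
Proof.
move=> ac; apply: cauchy_cvg; apply: cauchy_exP => e e0.
have [N aN] := ac _ (divr_gt0 e0 (ltr0Sn R 1)); exists (a N), N => // n /= Nn.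
rewrite -ball_normE /= (le_lt_trans (aN _ _ _ Nn))// ltr_pdivrMr// ltr_pMr//.
by rewrite ltr1n.
Qed.

Lemma cvg_sqrB (c l : R) (a : nat -> R) : a @ \oo --> l ->
  (c - a n) * (c - a n) @[n --> \oo] --> (c - l) * (c - l).
Proof.
move=> al; have h : c - a n @[n --> \oo] --> c - l by apply: cvgB => //;
  apply: cvg_cst.
exact: (cvgM h h).
Qed.

(** Coordinates converge, and a bound on all partial sums of the squared
    distance passes to the coordinatewise limit. *)
Fact l2_complete (x : nat -> l2) :
    (forall e, 0 < e -> exists N, forall m n, (N <= m)%N -> (N <= n)%N ->
      Num.sqrt (lrip (x m - x n) (x m - x n)) <= e) ->
    exists l, forall e, 0 < e -> exists N, forall n, (N <= n)%N ->
      Num.sqrt (lrip (x n - l) (x n - l)) <= e.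
Proof.
move=> xc.
have sq (a b : R) : 0 <= b -> a ^+ 2 <= b -> `|a| <= Num.sqrt b.
  by move=> b0 ab; rewrite -sqrtr_sqr ler_wsqrtr.
have cRe i : cvgn (fun n => complex.Re (x n i)).
  apply: real_cauchy_cvg => e e0; have [N xN] := xc e e0; exists N => m n mN nN.
  apply: le_trans (xN _ _ mN nN); apply: sq; first exact: lrip_ge0.
  apply: le_trans (coord_le_lrip _ i); rewrite l2BE;
    case: (x m i) (x n i) => a b [c d].
  by rewrite /dotc /= -!expr2 lerDl sqr_ge0.
have cIm i : cvgn (fun n => complex.Im (x n i)).
  apply: real_cauchy_cvg => e e0; have [N xN] := xc e e0; exists N => m n mN nN.
  apply: le_trans (xN _ _ mN nN); apply: sq; first exact: lrip_ge0.
  apply: le_trans (coord_le_lrip _ i); rewrite l2BE;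
    case: (x m i) (x n i) => a b [c d].
  by rewrite /dotc /= -!expr2 lerDr sqr_ge0.
pose l i : R[i] := limn (fun n => complex.Re (x n i)) +i* limn
  (fun n => complex.Im (x n i)).
have close e : 0 < e -> exists N, forall n, (N <= n)%N -> forall k,
    dot_sum (x n \- l) (x n \- l) k <= e ^+ 2.
  move=> e0; have [N xN] := xc e e0; exists N => n nN k.
  have c : dot_sum (x n \- x m) (x n \- x m) k @[m --> \oo] -->
      dot_sum (x n \- l) (x n \- l) k.
    apply: cvg_big => [|i _]; first exact: add_continuous.
    have -> : dotc ((x n \- l) i) ((x n \- l) i) =
       (complex.Re (x n i) - complex.Re (l i)) *
         (complex.Re (x n i) - complex.Re (l i)) +
       (complex.Im (x n i) - complex.Im (l i)) *
         (complex.Im (x n i) - complex.Im (l i)).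
      by rewrite /dotc /=; case: (x n i).
    have -> : (fun m => dotc ((x n \- x m) i) ((x n \- x m) i)) = (fun m =>
       (complex.Re (x n i) - complex.Re (x m i)) *
         (complex.Re (x n i) - complex.Re (x m i)) +
       (complex.Im (x n i) - complex.Im (x m i)) *
         (complex.Im (x n i) - complex.Im (x m i))).
      by apply/funext => m; rewrite /dotc /=; case: (x n i) (x m i) => a b [].
    by apply: cvgD; apply: cvg_sqrB; [exact: cRe|exact: cIm].
  rewrite -(cvg_lim _ c)//; apply: limr_le; first exact: cvgP c.
  exists N => // m /= mN; apply: le_trans (psum_le_lrip (x n - x m) k) _.
  have := xN _ _ nN mN; rewrite -(@ler_pXn2r _ 2%N) ?nnegrE ?sqrtr_ge0
    ?(ltW e0)//.
  by rewrite sqr_sqrtr ?lrip_ge0.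
have [N0 xN0] := close 1 ltr01.
have dl2 : (x N0 \- l) \in is_l2 by apply/asboolP; exists (1 ^+ 2) => n;
  exact: xN0.
have ll2 : l \in is_l2.
  have -> : l = (x N0 : nat -> R[i]) - (x N0 \- l) by apply/funext => i;
    rewrite !fctE opprB addrC subrK.
  by rewrite rpredB//; exact: (valP (x N0)).
exists (L2 ll2) => e e0; have [N xN] := close e e0; exists N => n nN.
rewrite -(ger0_norm (ltW e0)) -sqrtr_sqr ler_wsqrtr//.
by apply: lrip_le => k; exact: xN.
Qed.

Definition l2_hilbert : hilbert R :=
  @Hilbert R l2 lrip lripC lripDl lripZ lripJ lrip_ge0 lrip_eq0 l2_complete.
End L2.

(** * Operators of partial bijections *)

(** Relations rather than partial functions, so that inverses and compositions
    need no case analysis. *)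
Record pbij := PBij {
  prel :> nat -> nat -> Prop;
  pbij_fun : forall n m m', prel n m -> prel n m' -> m = m';
  pbij_inj : forall n n' m, prel n m -> prel n' m -> n = n'
}.

Definition pbijV (r : pbij) : pbij :=
  @PBij (fun n m => r m n) (fun n m m' => @pbij_inj r m m' n)
    (fun n n' m => @pbij_fun r m n n').

Definition pbijM (r r' : pbij) : pbij.
Proof.
refine (@PBij (fun n m => exists2 k, r' n k & r k m) _ _).
- move=> n m m' [k rk km] [k' rk' km'].
  by apply: pbij_fun km _; rewrite (pbij_fun rk rk').
- move=> n n' m [k rk km] [k' rk' km'].
  by apply: pbij_inj rk _; rewrite (pbij_inj km km').
Defined.

Section PartialBijections.
Variable R : realType.
Implicit Types (r : pbij) (u v : nat -> R[i]) (x y : l2 R).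

Definition origin r m : option nat :=
  if pselect (exists n, r n m) is left h then Some (projT1 (cid h)) else None.

Lemma origin_some r n m : r n m -> origin r m = Some n.
Proof.
rewrite /origin => rnm; case: pselect => [h|[]]; last by exists n.
by congr Some; case: cid => n' /= rn'; exact: (pbij_inj rn' rnm).
Qed.

Lemma originP r m : match origin r m with Some n => r n m | None =>
  forall n, ~ r n m end.
Proof.
rewrite /origin; case: pselect => [h|h]; first by case: cid.
by move=> n rnm; apply: h; exists n.
Qed.

(** The partial isometry that moves the n-th basis vector to the m-th one when r
    relates n to m, and kills the basis vectors outside of the domain. *)
Definition push r u : nat -> R[i] := fun m => oapp u 0 (origin r m).

Lemma pushE r u n m : r n m -> push r u m = u n.
Proof. by move=> /origin_some; rewrite /push => ->. Qed.

Lemma push0 r u m : (forall n, ~ r n m) -> push r u m = 0.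
Proof.
by rewrite /push => rm; have := originP r m; case: origin => // n /rm.
Qed.

(** Unconditional summability of nonnegative families, in the only form that
    reindexing by a partial bijection needs. *)
Lemma sum_uniq_le (a : nat -> R) (s : seq nat) (K : R) : (forall n, 0 <= a n) ->
  (forall n, \sum_(i < n) a i <= K) -> uniq s -> \sum_(n <- s) a n <= K.
Proof.
move=> a0 aK us; pose M := (\max_(n <- s) n).+1.
have sM n : n \in s -> (n < M)%N by move=> ns; rewrite ltnS leq_bigmax_seq.
apply: le_trans (aK M); rewrite -(big_mkord xpredT).
have /(perm_big _) -> : perm_eq s [seq i <- index_iota 0 M | i \in s].
  apply: uniq_perm => //; first by rewrite filter_uniq ?iota_uniq.
  by move=> n; rewrite mem_filter mem_index_iota leq0n /=;
    case: (boolP (n \in s)) => // /sM ->.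
by rewrite big_filter big_mkcond; apply: ler_sum => i _; case: ifP.
Qed.

Lemma push_psum_le r u (K : R) : (forall n, dot_sum u u n <= K) ->
  forall n, dot_sum (push r u) (push r u) n <= K.
Proof.
move=> uK n; pose a i := dotc (u i) (u i).
have -> : dot_sum (push r u) (push r u) n =
  \sum_(i <- pmap (origin r) (index_iota 0 n)) a i.
  rewrite /dot_sum -(big_mkord xpredT
    (fun i => dotc (push r u i) (push r u i))).
  elim: (index_iota 0 n) => [|m s IHs]; rewrite ?big_nil//= big_cons IHs /push.
  by case: origin => [i|] /=; rewrite ?big_cons// dotc0 add0r.
apply: sum_uniq_le => //; first by move=> i; exact: dotc_ge0.
apply: (@pmap_uniq _ _ _ (fun i => odflt 0%N (origin (pbijV r) i))).
  move=> m; have := originP r m; case: origin => //= i rim.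
  by rewrite (_ : origin (pbijV r) i = Some m)//; apply: origin_some.
exact: iota_uniq.
Qed.

Fact push_l2 r x : push r x \in @is_l2 R.
Proof.
apply/asboolP; have [K xK] := l2P x; exists K; exact: push_psum_le.
Qed.

Definition pushl r x : l2 R := L2 (push_l2 r x).

Lemma pushl_le r x : lrip (pushl r x) (pushl r x) <= lrip x x.
Proof. by apply: lrip_le; apply: push_psum_le; exact: psum_le_lrip. Qed.

Lemma pushl_lin r (c : R[i]) x y : pushl r (c *: x + y) = c *:
  pushl r x + pushl r y.
Proof.
apply: l2_eq => m; rewrite l2DE l2ZE /= /push.
by case: origin => //=; rewrite mulr0 addr0.
Qed.

Lemma pushlV r x n : pushl (pbijV r) (pushl r x) n =
  if pselect (exists m, r n m) then x n else 0.
Proof.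
case: pselect => [[m rnm]|nr] /=; last first.
  by apply: push0 => m rnm; apply: nr; exists m.
by rewrite (@pushE _ _ m)//=; apply: pushE.
Qed.

Lemma pushlK r x : pushl r (pushl (pbijV r) (pushl r x)) = pushl r x.
Proof.
apply: l2_eq => m; have := originP r m; case E: (origin r m) => [n|] rm.
  rewrite -[LHS]/(push r (pushl (pbijV r) (pushl r x)) m) (pushE _ rm) pushlV.
  by rewrite -[RHS]/(push r x m) (pushE _ rm); case: pselect => // -[];
    exists m.
by rewrite /= !push0.
Qed.

(** push r is contractive, and so is its inverse; hence it is isometric on its
    initial space, and preserves inner products there by polarization. *)
Lemma lrip_pushl r x y : lrip (pushl r x) (pushl r y) =
  lrip (pushl (pbijV r) (pushl r x)) (pushl (pbijV r) (pushl r y)).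
Proof.
have iso z : lrip (pushl r z) (pushl r z) =
    lrip (pushl (pbijV r) (pushl r z)) (pushl (pbijV r) (pushl r z)).
  apply/le_anti; rewrite pushl_le andbT -{1 2}pushlK.
  exact: pushl_le.
have linD r' a b : pushl r' a + pushl r' b = pushl r' (a + b).
  by rewrite -[a in RHS]scale1r pushl_lin scale1r.
have linB r' a b : pushl r' a - pushl r' b = pushl r' (a - b).
  by rewrite addrC -scaleN1r -pushl_lin scaleN1r addrC.
rewrite [LHS]lrip_polar [RHS]lrip_polar (linD r x y) (linB r x y) !iso.
by rewrite -(linD r x y) -(linB r x y) -!(linB (pbijV r)) -!(linD (pbijV r)).
Qed.

Lemma eq_lrip x y x' y' : (forall i, dotc (x i) (y i) = dotc (x' i) (y' i)) ->
  lrip x y = lrip x' y'.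
Proof.
by move=> h; rewrite /lrip; congr (limn _); apply/funext => n;
  apply: eq_bigr => i _.
Qed.

(** Only the coordinates in the range of r contribute on the left, only those in
    its domain on the right; between the two push r preserves inner products. *)
Lemma pushl_adj r x y : lrip (pushl r x) y = lrip x (pushl (pbijV r) y).
Proof.
transitivity (lrip (pushl r x) (pushl r (pushl (pbijV r) y))).
  apply: eq_lrip => m; have := originP r m; case: (origin r m) => [n|] rm /=.
    by rewrite !(pushE _ rm) (@pushE (pbijV r) _ m n).
  by rewrite !push0// !dotc0.
rewrite lrip_pushl; apply: eq_lrip => n; rewrite !pushlV.
case: pselect => // nr /=; rewrite push0; first by rewrite !(dotcC _ 0) !dotc0.
by move=> m rnm; apply: nr; exists m.
Qed.

Fact pushl_is_op r : pushl r \in @is_op R (l2_hilbert R).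
Proof.
apply/asboolP; split.
- exact: pushl_lin.
- exists 1; split=> // x; rewrite mul1r /hnorm ler_wsqrtr//.
  exact: pushl_le.
- by exists (pushl (pbijV r)) => x y; exact: pushl_adj.
Qed.

Definition pbop r : op (l2_hilbert R) := Op (pushl_is_op r).

Lemma pbop_adj r : op_adj (pbop r) = pbop (pbijV r).
Proof. by apply: op_adj_uniq => u v; exact: pushl_adj. Qed.

Lemma eq_pbop r r' : (forall n m, r n m <-> r' n m) -> pbop r = pbop r'.
Proof.
move=> rr'; apply: op_eq => u; apply: l2_eq => m /=.
have := originP r' m; case: (origin r' m) => [n|] rm.
  by rewrite (pushE _ rm); apply: pushE; apply/rr'.
by rewrite !push0// => n /rr'; exact: rm.
Qed.

Lemma pbop_mul r r' : op_mul (pbop r) (pbop r') = pbop (pbijM r r').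
Proof.
apply: op_eq => u; apply: l2_eq => m /=.
have := originP r m; case: (origin r m) => [n|] rm; last first.
  by rewrite !push0// => n [k _ /rm].
rewrite (pushE _ rm); have := originP r' n; case: (origin r' n) => [k|] rn.
  by rewrite (pushE _ rn) (@pushE _ _ k)//; exists n.
rewrite !push0// => k [n' rk rnm]; apply: (rn k).
by rewrite -(pbij_inj rnm rm).
Qed.

Lemma pbop_0 r : (forall n m, ~ r n m) -> pbop r = 0.
Proof. by move=> r0; apply: op_eq => u; apply: l2_eq => m; exact: push0. Qed.

End PartialBijections.

(** * Norm and square roots in a C*-algebra *)

Section CStarNorm.
Variables (R : realType) (D : cstar_algebra R).
Implicit Types (x y z : D).

Definition rnorm x : R := complex.Re `|x|.

Lemma normE x : `|x| = (rnorm x)%:C.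
Proof. by rewrite /rnorm RRe_real// normr_real. Qed.

Lemma rnorm_ge0 x : 0 <= rnorm x.
Proof. by rewrite -ler0c -normE normr_ge0. Qed.
Lemma rnormD x y : rnorm (x + y) <= rnorm x + rnorm y.
Proof. by rewrite -lecR rmorphD /= -!normE ler_normD. Qed.
Lemma rnormM x y : rnorm (x ** y) <= rnorm x * rnorm y.
Proof. by rewrite -lecR rmorphM /= -!normE cnormM. Qed.
Lemma rnormN x : rnorm (- x) = rnorm x.
Proof. by rewrite /rnorm normrN. Qed.
Lemma rnormZ (r : R) x : 0 <= r -> rnorm (r%:C *: x) = r * rnorm x.
Proof.
move=> r0; apply: complexI; rewrite rmorphM /= -!normE normrZ ger0_norm//.
by rewrite ler0c.
Qed.
Lemma rnorm0 : rnorm 0 = 0. Proof. by rewrite /rnorm normr0. Qed.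
Lemma rnorm_small x : (forall e, 0 < e -> rnorm x <= e) -> x = 0.
Proof.
move=> xe; have x0 : rnorm x = 0.
  apply/le_anti; rewrite rnorm_ge0 andbT.
  by apply/ler_addgt0Pr => e e0; rewrite add0r xe.
by apply/eqP; rewrite -normr_eq0 normE x0.
Qed.

Lemma cmulNr x y : x ** (- y) = - (x ** y).
Proof. by rewrite -scaleN1r cmulZr scaleN1r. Qed.
Lemma cmulNl x y : (- x) ** y = - (x ** y).
Proof. by rewrite -scaleN1r cmulZl scaleN1r. Qed.
Lemma cmulBr x y z : x ** (y - z) = x ** y - x ** z.
Proof. by rewrite cmulDr cmulNr. Qed.
Lemma cmulBl x y z : (x - y) ** z = x ** z - y ** z.
Proof. by rewrite cmulDl cmulNl. Qed.
Lemma adj0 : adj 0 = 0 :> D.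
Proof. by apply: (@addIr _ (adj 0)); rewrite -adjD !add0r. Qed.
Lemma adjB x y : adj (x - y) = adj x - adj y.
Proof. by rewrite adjD -[- y]scaleN1r Defs.adjZ rmorphN1 scaleN1r. Qed.
Lemma adj_realZ (r : R) x : adj (r%:C *: x) = r%:C *: adj x.
Proof. by rewrite Defs.adjZ -[Num.conj _]/(conjc _) conjc_real. Qed.

Lemma rnorm_cstar x : rnorm (adj x ** x) = rnorm x ^+ 2.
Proof. by apply: complexI; rewrite rmorphXn /= -!normE cnorm_adj. Qed.

Lemma rnorm_adj x : rnorm (adj x) = rnorm x.
Proof.
suff le y : rnorm y <= rnorm (adj y).
  by apply/le_anti; rewrite le andbT -{2}(adjK x) le.
have [->|/eqP y0] := eqVneq (rnorm y) 0; first exact: rnorm_ge0.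
have yp : 0 < rnorm y by rewrite lt_def rnorm_ge0 andbT; apply/eqP.
by rewrite -(ler_pM2r yp) -expr2 -rnorm_cstar rnormM.
Qed.

Lemma cstar_complete (x : nat -> D) :
  (forall e, 0 < e -> exists N, forall m n, (N <= m)%N -> (N <= n)%N ->
    rnorm (x m - x n) <= e) ->
  exists l, forall e, 0 < e -> exists N, forall n, (N <= n)%N ->
    rnorm (x n - l) <= e.
Proof.
move=> xc; have : cvg (x @ \oo).
  apply: cauchy_cvg; apply: cauchy_exP => e e0.
  have [e' ee' e'0] : exists2 e' : R, e = e'%:C & 0 < e'.
    by move: e0; case: e => a b; rewrite ltcE /= => /andP[/eqP -> a0]; exists a.
  have [N xN] := xc _ (divr_gt0 e'0 (ltr0Sn R 1));
    exists (x N), N => // n /= Nn.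
  rewrite -ball_normE /= normE ee' ltcR (le_lt_trans (xN _ _ _ Nn))//.
  by rewrite ltr_pdivrMr// ltr_pMr// ltr1n.
move=> /cvg_ex[l xl]; exists l => e e0.
move/cvgrPdist_le : xl => /(_ e%:C); rewrite ltcR => /(_ e0)[N _ xN].
exists N => n Nn; have := xN n Nn.
by rewrite normE lecR -rnormN opprB.
Qed.

Section OneMinusSquareRoot.
Variable h : D.
Hypotheses (hsa : adj h = h) (h4 : rnorm h <= 4^-1).

Definition one_half : R := 2^-1.

Fixpoint root_iter n : D :=
  if n is m.+1 then one_half%:C *: (h + root_iter m ** root_iter m) else 0.

Lemma one_half_ge0 : 0 <= one_half. Proof. by rewrite /one_half invr_ge0. Qed.

Lemma root_iter_sa n : adj (root_iter n) = root_iter n.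
Proof.
elim: n => [|n IHn] /=; first exact: adj0.
by rewrite adj_realZ adjD adjM hsa IHn.
Qed.

Lemma root_iter_le n : rnorm (root_iter n) <= 4^-1.
Proof.
elim: n => [|n IHn] /=; first by rewrite rnorm0 invr_ge0.
rewrite rnormZ ?one_half_ge0//.
have h1 := rnormD h (root_iter n ** root_iter n).
have h2 := rnormM (root_iter n) (root_iter n).
have h3 := rnorm_ge0 (root_iter n).
have h5 : rnorm (root_iter n) * rnorm (root_iter n) <= 4^-1 * 4^-1 by rewrite
  ler_pM.
have h6 := h4; rewrite /one_half; move: h1 h2 h5 h6;
  move: (rnorm (h + _)) (rnorm h) (rnorm (_ ** _)) (rnorm _ * rnorm _) =>
    a b c d.
lra.
Qed.

Lemma rnorm_sqrB x y : rnorm (x ** x - y ** y) <=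
  (rnorm x + rnorm y) * rnorm (x - y).
Proof.
have -> : x ** x - y ** y = x ** (x - y) + (x - y) ** y.
  by rewrite cmulBr cmulBl subrKA.
by rewrite (le_trans (rnormD _ _))// mulrDl lerD// (le_trans (rnormM _ _))//
  mulrC.
Qed.

Lemma root_iter_step n : rnorm (root_iter n.+1 - root_iter n) <= one_half ^+ n.
Proof.
elim: n => [|n IHn].
  rewrite expr0 subr0 (le_trans (root_iter_le 1))//.
  by rewrite invf_le1// ler1n.
have -> : root_iter n.+2 - root_iter n.+1 = one_half%:C *:
    (root_iter n.+1 ** root_iter n.+1 - root_iter n ** root_iter n).
  by rewrite /= -scalerBr opprD addrACA subrr add0r.
rewrite rnormZ ?one_half_ge0// exprS ler_wpM2l ?one_half_ge0//.
apply: le_trans (rnorm_sqrB _ _) _; apply: le_trans IHn.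
rewrite ler_piMl ?rnorm_ge0//.
by have := root_iter_le n; have := root_iter_le n.+1; lra.
Qed.

Lemma root_iter_tail m n : rnorm (root_iter (n + m) - root_iter n) <= 2 *
  one_half ^+ n.
Proof.
suff : rnorm (root_iter (n + m) - root_iter n) <= 2 *
  (one_half ^+ n - one_half ^+ (n + m)).
  move=> h1; apply: le_trans h1 _; rewrite ler_wpM2l//.
  by rewrite gerBl exprn_ge0// one_half_ge0.
elim: m => [|m IHm]; first by rewrite addn0 !subrr rnorm0 mulr0.
rewrite -[_ - root_iter n](subrKA (root_iter (n + m))) addnS.
apply: le_trans (rnormD _ _) _; apply: le_trans (lerD (root_iter_step _) IHm) _.
by rewrite exprS; move: (one_half ^+ _) (one_half ^+ _) => a b;
  rewrite /one_half; lra.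
Qed.

(** If 1 - h = (1 - c)^2, then h = 2 c - c^2. So c is a fixed point of
    c |-> (h + c^2) / 2, which contracts the ball of radius 1/4. The equation
    makes sense without unit. *)
Lemma one_minus_root : exists2 c, adj c = c & h = 2%:R *: c - c ** c.
Proof.
have [|c cl] := @cstar_complete root_iter.
  move=> e e0.
  have [N N2] : exists N, 4 * one_half ^+ N <= e.
    have h2 : `|one_half| < 1 by rewrite ger0_norm ?one_half_ge0// invf_lt1//
      ltr1n.
    have /cvgrPdist_le/(_ (e / 4)) := cvg_expr h2.
    case=> [|N _ /(_ N)/=]; first by rewrite divr_gt0.
    move=> /(_ (leqnn N)); rewrite sub0r normrN normrX (ger0_norm one_half_ge0)
      => hN.
    by exists N; rewrite mulrC -ler_pdivlMr.
  exists N => m n mN nN.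
  rewrite -[_ - root_iter n](subrKA (root_iter N)).
  apply: le_trans (rnormD _ _) _.
  have := root_iter_tail (m - N) N; have := root_iter_tail (n - N) N.
  rewrite !subnKC// -[rnorm (root_iter n - _)]rnormN opprB => h1 h2.
  by move: h1 h2 N2; move: (one_half ^+ N) => a; lra.
have csmall e : 0 < e -> exists n, rnorm (root_iter n - c) <= e /\
    rnorm (root_iter n.+1 - c) <= e.
  move=> /cl[N cN]; exists N; split; first exact: cN.
  exact/cN/leqW.
exists c.
  apply/eqP; rewrite -subr_eq0; apply/eqP/rnorm_small => e e0.
  have [n [cn _]] := csmall _ (divr_gt0 e0 (ltr0Sn R 1)).
  have -> : adj c - c = - adj (root_iter n - c) + (root_iter n - c).
    by rewrite adjB root_iter_sa opprB subrKA.
  rewrite (le_trans (rnormD _ _))// rnormN rnorm_adj [leRHS]splitr.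
  exact: lerD.
have fix_c : c = one_half%:C *: (h + c ** c).
  apply/eqP; rewrite -subr_eq0; apply/eqP/rnorm_small => e e0.
  have Kp : 0 < 2 + rnorm c by rewrite ltr_wpDr ?rnorm_ge0.
  have [n [cn cn1]] := csmall _ (divr_gt0 e0 Kp).
  have -> : c - one_half%:C *: (h + c ** c) = - (root_iter n.+1 - c) +
      one_half%:C *: (root_iter n ** root_iter n - c ** c).
    rewrite /= opprB -addrA; congr (_ + _).
    by rewrite -!scalerN -scalerDr !opprD subrKA.
  rewrite (le_trans (rnormD _ _))// rnormN rnormZ ?one_half_ge0//.
  have h1 := rnorm_sqrB (root_iter n) c.
  have h2 := root_iter_le n; have h3 := rnorm_ge0 c.
  have h5 := rnorm_ge0 (root_iter n - c).
  have h6 : one_half * rnorm (root_iter n ** root_iter n - c ** c) <=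
    (1 + rnorm c) * rnorm (root_iter n - c).
    apply: le_trans (_ : 1 * rnorm (root_iter n ** root_iter n - c ** c) <= _).
      by rewrite ler_wpM2r ?rnorm_ge0// invf_le1// ler1n.
    rewrite mul1r (le_trans h1)// ler_wpM2r// lerD2r (le_trans h2)//.
    by rewrite invf_le1// ler1n.
  have -> : e = e / (2 + rnorm c) + (1 + rnorm c) * (e / (2 + rnorm c)).
    by field; rewrite gt_eqF.
  rewrite lerD// (le_trans h6)// ler_wpM2l// addr_ge0//.
have -> : 2%:R *: c = h + c ** c.
  rewrite {1}fix_c scalerA (_ : 2%:R * one_half%:C = 1) ?scale1r//.
  by rewrite -(rmorph_nat (real_complex R)) -rmorphM /one_half divff ?pnatr_eq0.
by rewrite addrK.
Qed.

End OneMinusSquareRoot.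
End CStarNorm.

(** * Rank one projections exclude pure infiniteness *)

Local Notation cplx R := (R[i] : numFieldType).

(** Singular 2 x 2 matrices form a closed set. *)
Lemma lim_det_eq0 (K : numFieldType) (f g h k : nat -> K) (a b c d : K) :
  f @ \oo --> a -> g @ \oo --> b -> h @ \oo --> c -> k @ \oo --> d ->
  (forall n, f n * g n - h n * k n = 0) -> a * b - c * d = 0.
Proof.
move=> fa gb hc kd fghk.
have lim : f n * g n - h n * k n @[n --> \oo] --> a * b - c * d.
  by apply: cvgB; apply: cvgM.
rewrite (_ : (fun n => _) = (fun=> 0)) in lim; last exact/funext.
by rewrite -(cvg_lim _ lim)//; apply: cvg_lim => //; exact: cvg_cst.
Qed.

Section RankOneProjection.
Variables (R : realType) (D : cstar_algebra R) (phi : D -> R[i]) (P : D).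
Implicit Types (x y z : D).

(** The properties of x |-> <f x e, e> when e is a unit vector spanning the
    range of the projection f P, for a *-homomorphism f into bounded operators.
    The last one is what rank one means for f P; boundedness follows. *)
Record rank_one_state : Prop := RankOneState {
  stateD : forall x y, phi (x + y) = phi x + phi y;
  stateZ : forall (c : R[i]) x, phi (c *: x) = c * phi x;
  state_adj : forall x, phi (adj x) = Num.conj (phi x);
  state_ge0 : forall x, 0 <= phi (adj x ** x);
  state_proj : is_projection P;
  stateP : phi P = 1;
  stateM : forall x y, phi (x ** P ** y) = phi x * phi y
}.

Hypothesis phiS : rank_one_state.

Let Pa : adj P = P. Proof. by have [] := state_proj phiS. Qed.
Let PP : P ** P = P. Proof. by have [] := state_proj phiS. Qed.

Lemma stateN x : phi (- x) = - phi x.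
Proof. by rewrite -scaleN1r (stateZ phiS) mulN1r. Qed.
Lemma stateB x y : phi (x - y) = phi x - phi y.
Proof. by rewrite (stateD phiS) stateN. Qed.
Lemma state_Pl x : phi (P ** x) = phi x.
Proof. by rewrite -{1}PP (stateM phiS) (stateP phiS) mul1r. Qed.
Lemma state_Pr x : phi (x ** P) = phi x.
Proof. by rewrite -PP cmulA (stateM phiS) (stateP phiS) mulr1. Qed.

(** Positivity gives boundedness: for h = adj x ** x small, 1 - phi h is the
    value of phi at the square of P - c, where 1 - h = (1 - c)^2; and positivity
    at x - phi x *: P bounds |phi x|^2 by phi h. *)
Lemma state_small x : rnorm x <= 2^-1 -> `|phi x| <= 1.
Proof.
move=> x2.
have [||c ca hc] := @one_minus_root R D (adj x ** x).
- by rewrite adjM adjK.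
- rewrite rnorm_cstar expr2.
  have h := ler_pM (rnorm_ge0 x) (rnorm_ge0 x) x2 x2.
  by apply: le_trans h _; lra.
have phih : phi (adj x ** x) <= 1.
  rewrite -subr_ge0.
  suff -> : 1 - phi (adj x ** x) = phi (adj (P - c) ** (P - c)) by exact:
    state_ge0.
  rewrite adjB Pa ca cmulBl !cmulBr PP !stateB state_Pl state_Pr (stateP phiS).
  rewrite hc stateB (stateZ phiS); ring.
have: 0 <= phi (adj (x - phi x *: P) ** (x - phi x *: P)) by exact: state_ge0.
rewrite adjB Defs.adjZ Pa cmulBl !cmulBr !cmulZl !cmulZr PP.
rewrite !stateB !(stateZ phiS) state_Pr state_Pl (state_adj phiS) (stateP phiS).
rewrite mulr1 [phi x * _]mulrC subrr subr0 mulrC -normCK subr_ge0 => h.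
by rewrite -(@expr_le1 _ 2%N) ?normr_ge0// (le_trans h).
Qed.

Lemma state_bounded x : `|phi x| <= 2%:R * `|x|.
Proof.
have [->|x0] := eqVneq x 0.
  by rewrite -(scale0r P) (stateZ phiS) mul0r normr0 mulr_ge0// ler0n.
have xp : 0 < `|x| by rewrite normr_gt0.
pose c : R[i] := (2%:R * `|x|)^-1.
have c0 : 0 < c by rewrite invr_gt0 mulr_gt0// ltr0n.
have xc : rnorm (c *: x) <= 2^-1.
  rewrite -lecR -normE normrZ (gtr0_norm c0) /c invfM -mulrA mulVf ?gt_eqF//.
  by rewrite mulr1 fmorphV /= rmorph_nat.
have := state_small xc.
rewrite (stateZ phiS) normrM (gtr0_norm c0) /c.
by rewrite ler_pdivrMl ?mulr1// mulr_gt0// ltr0n.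
Qed.

Lemma bounded_cvg (psi : D -> R[i]) (K : R[i]) (b : nat -> D) a :
  0 < K -> (forall x y, psi (x - y) = psi x - psi y) ->
  (forall x, `|psi x| <= K * `|x|) ->
  b k @[k --> \oo] --> a -> (psi (b k) : cplx R) @[k --> \oo] -->
    (psi a : cplx R).
Proof.
move=> K0 psiB psiK /cvgrPdist_le ba; apply/cvgrPdist_le => e e0.
have := ba (e / K); rewrite divr_gt0// => /(_ isT); apply: filterS => k h.
rewrite -psiB (le_trans (psiK _))// -ler_pdivlMl// mulrC//.
Qed.

(** If phi is not multiplicative at x, y, then the components of adj x and y
    orthogonal to the range of P have a nonzero inner product; by polarization
    one of their linear combinations has nonzero length. *)
Lemma not_character_witness : (~ exists f, @is_character R D f) ->
  exists z, [/\ z ** P = z, phi z = 0 & phi (adj z ** z) != 0].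
Proof.
move=> nchar; apply: contrapT => nz.
have q0 z : z ** P = z -> phi z = 0 -> phi (adj z ** z) = 0.
  by move=> zP z0; apply: contrapT => /eqP h; apply: nz; exists z.
(* Expansion of the vanishing length of v + c u. *)
have cross u v c : u ** P = u -> v ** P = v -> phi u = 0 -> phi v = 0 ->
    c * phi (adj v ** u) + Num.conj (c * phi (adj v ** u)) = 0.
  move=> uP vP u0 v0; have := q0 (v + c *: u).
  rewrite cmulDl cmulZl uP vP (stateD phiS) (stateZ phiS) u0 v0 mulr0 addr0.
  move=> /(_ erefl erefl); rewrite adjD Defs.adjZ cmulDl !cmulDr !cmulZl
    !cmulZr.
  rewrite !(stateD phiS) !(stateZ phiS) (q0 v)// (q0 u)// !mulr0 addr0 add0r =>
    <-.
  rewrite rmorphM; congr (_ + _ * _).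
  by rewrite -[adj u ** v]adjK adjM adjK (state_adj phiS).
apply: nchar; exists phi; split; first exact: stateD.
- exact: stateZ.
- move=> x y; apply: contrapT => /eqP; rewrite -subr_eq0 => /eqP; apply.
  pose u := y ** P - phi y *: P; pose v := adj x ** P - Num.conj (phi x) *: P.
  have uP : u ** P = u by rewrite cmulBl -cmulA PP cmulZl PP.
  have vP : v ** P = v by rewrite cmulBl -cmulA PP cmulZl PP.
  have u0 : phi u = 0.
    by rewrite stateB (stateZ phiS) state_Pr (stateP phiS) mulr1 subrr.
  have v0 : phi v = 0.
    by rewrite stateB (stateZ phiS) state_Pr (stateP phiS) mulr1
      (state_adj phiS) subrr.
  have -> : phi (x ** y) - phi x * phi y = phi (adj v ** u).
    rewrite adjB Defs.adjZ adjM adjK Pa conjCK cmulBl !cmulBr !cmulZl !cmulZr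
      PP.
    rewrite !stateB !(stateZ phiS) -!cmulA !state_Pl cmulA !state_Pr
      (stateP phiS).
    by ring.
  set w := phi (adj v ** u).
  have crossw c : c * w + Num.conj (c * w) = 0 by exact: cross.
  have h1 := crossw 1; have h2 := crossw 'i.
  rewrite !mul1r in h1; rewrite rmorphM /= in h2.
  have wE : Num.conj w = - w by apply/eqP; rewrite -addr_eq0 addrC h1.
  move: h2; rewrite wE -[Num.conj 'i]/(0 -i* 1).
  have -> : (0 -i* 1 : R[i]) = - 'i by apply/eqP;
    rewrite eq_complex /= oppr0 !eqxx.
  rewrite mulrNN -mulr2n -mulr_natr => /eqP.
  by rewrite !mulf_eq0 pnatr_eq0 orbF => /orP[/eqP[/eqP]|/eqP//];
    rewrite oner_eq0.
- by exists P; rewrite (stateP phiS) oner_neq0.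
Qed.

(** The Gram matrix of b on the vectors P, z has the entries phi b,
    phi (b ** z), phi (adj z ** b), phi (adj z ** b ** z). It is singular for
    b = adj x ** P ** x, of rank at most one, hence for every limit of such b.
    For the square of w its diagonal is 1, t^3 with t = phi (adj z ** z), and
    one of the other entries vanishes. *)
Lemma not_cuntz_sub z : z ** P = z -> phi z = 0 -> phi (adj z ** z) != 0 ->
  let w := P + z ** adj z in ~ cuntz_sub (adj w ** w) P.
Proof.
move=> zP z0 t0 w [x xa]; set a := adj w ** w in xa;
  set t := phi (adj z ** z) in t0.
have wa : adj w = w by rewrite /w adjD adjM adjK Pa.
have za0 : phi (adj z) = 0 by rewrite (state_adj phiS) z0 rmorph0.
(* The summand z ** adj z of w contributes a multiple of phi z. *)
have wl y : phi (w ** y) = phi y.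
  rewrite cmulDl (stateD phiS) state_Pl -{1}zP -!cmulA cmulA (stateM phiS) z0.
  by rewrite mul0r addr0.
have zwl y : phi (adj z ** (w ** y)) = t * phi (adj z ** y).
  rewrite cmulDl cmulDr (stateD phiS) cmulA (stateM phiS) za0 mul0r add0r.
  have -> : adj z ** (z ** adj z ** y) = (adj z ** z) ** P ** (adj z ** y).
    by rewrite -[adj z ** z ** P]cmulA zP !cmulA.
  by rewrite (stateM phiS).
have cvgL : (phi (adj (x k) ** P ** x k) : cplx R) @[k --> \oo] -->
  (phi a : cplx R).
  apply: (bounded_cvg (K := 2%:R)) => //; [exact: stateB|exact: state_bounded].
have cvg1 : (phi (adj (x k) ** P ** x k ** z) : cplx R) @[k --> \oo] -->
  (phi (a ** z) : cplx R).
  apply: (bounded_cvg (psi := fun b => phi (b ** z)) (K := 2%:R * (`|z| + 1)))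
    => //.
  - by move=> b c; rewrite cmulBl stateB.
  - move=> b; rewrite (le_trans (state_bounded _))// -mulrA ler_wpM2l ?ler0n//.
    by rewrite (le_trans (cnormM _ _))// mulrC ler_wpM2r// lerDl.
have cvg2 : (phi (adj z ** (adj (x k) ** P ** x k)) : cplx R) @[k --> \oo] -->
  (phi (adj z ** a) : cplx R).
  apply: (bounded_cvg (psi := fun b => phi (adj z ** b))
    (K := 2%:R * (`|adj z| + 1))) => //.
  - by move=> b c; rewrite cmulBr stateB.
  - move=> b; rewrite (le_trans (state_bounded _))// -mulrA ler_wpM2l ?ler0n//.
    by rewrite (le_trans (cnormM _ _))// ler_wpM2r// lerDl.
have cvg3 : (phi (adj z ** (adj (x k) ** P ** x k) ** z) : cplx R) @[k --> \oo]
  --> (phi (adj z ** a ** z) : cplx R).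
  apply: (bounded_cvg (psi := fun b => phi (adj z ** b ** z))
    (K := 2%:R * (`|adj z| * `|z| + 1))) => //.
  - by move=> b c; rewrite cmulBr cmulBl stateB.
  - move=> b; rewrite (le_trans (state_bounded _))// -mulrA ler_wpM2l ?ler0n//.
    rewrite (le_trans (cnormM _ _))// (le_trans (ler_wpM2r _ (cnormM _ _)))//.
    by rewrite mulrAC ler_wpM2r// lerDl.
have : phi a * phi (adj z ** a ** z) - phi (a ** z) * phi (adj z ** a) = 0.
  apply: (@lim_det_eq0 (cplx R) _ _ _ _ _ _ _ _ cvgL cvg3 cvg1 cvg2) => k.
  rewrite !cmulA -[_ ** x k ** z]cmulA (stateM phiS) -[_ ** x k ** z]cmulA
    !(stateM phiS).
  by ring.
rewrite /a wa -!cmulA !wl !zwl z0 mul0r subr0.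
rewrite -[phi w]state_Pr wl (stateP phiS) mul1r => /eqP.
by rewrite !mulf_eq0 !(negPf t0).
Qed.

(** Either phi is a character, or the square of P + z ** adj z lies in the
    closed ideal generated by P without being Cuntz below P. *)
Lemma rank_one_not_purely_infinite : ~ purely_infinite D.
Proof.
case=> nchar cuntz; have [z [zP z0 t0]] := not_character_witness nchar.
apply: (not_cuntz_sub zP z0 t0); apply/cuntz.
- by eexists.
- by exists P; rewrite Pa PP.
- move=> S [[[_ S0 SD SZ] SM] PS].
  have SP : S P by exact: PS.
  have Sw : S (P + z ** adj z).
    by apply: SD => //; apply: (SM _ _ _).1; rewrite -zP; apply: (SM _ _ SP).2.
  by have [] := SM _ (adj (P + z ** adj z)) Sw.
Qed.
End RankOneProjection.

(** * The ring of sets of a labeled space *)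

Section LabeledSpaceSets.
Variable G : labeled_graph.
Hypothesis hG : labeled_space G.
Implicit Types (A B C : set (vertex G)) (a : letter G)
  (al be ga : seq (letter G)).

(** An intersection of collections closed in this way is closed in this way. *)
Lemma calE_closed :
  accommodating (calE (G := G)) /\ forall A B, calE A -> calE B ->
    calE (A `\` B).
Proof.
split; [split|].
- by move=> C [[[C0 _ _ _ _] _] _].
- by move=> al hal C [[acc aD] sC]; case: acc => _ + _ _ _; apply.
- by move=> A al hA hal C hC; case: (hC) => [[[_ _ + _ _] _] _]; apply => //;
    exact: hA.
- by move=> A B hA hB C hC; case: (hC) => [[[_ _ _ + _] _] _]; apply;
    [exact: hA|exact: hB].
- by move=> A B hA hB C hC; case: (hC) => [[[_ _ _ _ +] _] _]; apply;
    [exact: hA|exact: hB].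
- by move=> A B hA hB C hC; case: (hC) => [[_ +] _]; apply;
    [exact: hA|exact: hB].
Qed.

Lemma calE0 : calE (G := G) set0. Proof. by case: calE_closed => -[]. Qed.
Lemma calE_range al : labeled_path al -> calE (range_of al).
Proof. by case: calE_closed => -[_ + _ _ _] _; apply. Qed.
Lemma calEU A B : calE A -> calE B -> calE (A `|` B).
Proof. by case: calE_closed => -[_ _ _ + _] _; apply. Qed.
Lemma calEI A B : calE A -> calE B -> calE (A `&` B).
Proof. by case: calE_closed => -[_ _ _ _ +] _; apply. Qed.
Lemma calED A B : calE A -> calE B -> calE (A `\` B).
Proof. by case: calE_closed => _; apply. Qed.

Lemma labeled_path1 a : labeled_path [:: a].
Proof. by have [e ea] := lab_onto a; exists e, [::]; rewrite /path_label /= ea.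
  Qed.

Definition step A a := rel_range A [:: a].

Lemma stepP A a v : step A a v <-> exists e,
  [/\ A (src e), lab e = a & tgt e = v].
Proof.
split=> [[e [[|f p] [_ Ae]]]|[e [Ae ea ev]]] //=.
  by move=> [ea] ev; exists e.
by exists e, [::]; rewrite /path_label /= ea.
Qed.

Lemma calE_step A a : calE A -> calE (step A a).
Proof.
by move=> hA; case: calE_closed => -[_ _ + _ _] _; apply => //;
  exact: labeled_path1.
Qed.

Lemma stepS A B a : A `<=` B -> step A a `<=` step B a.
Proof. by move=> AB v /stepP[e [Ae ea ev]]; apply/stepP; exists e; split=> //;
  exact: AB. Qed.

Lemma stepU A B a : step (A `|` B) a = step A a `|` step B a.
Proof.
apply/seteqP; split=> [v /stepP[e [[]Ae ea ev]]|v [|]].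
- by left; apply/stepP; exists e.
- by right; apply/stepP; exists e.
- exact/stepS/subsetUl.
- exact/stepS/subsetUr.
Qed.

Lemma stepI A B a : calE A -> calE B -> step (A `&` B) a = step A a `&` step B
  a.
Proof.
by move=> hA hB; rewrite /step (weakly_left_resolving hG)//;
  exact: labeled_path1.
Qed.

Lemma step_range A a : step A a `<=` range_of [:: a].
Proof. by move=> v [e [p [ep _ pa ev]]]; exists e, p. Qed.

Lemma rel_range_range A al : rel_range A al `<=` range_of al.
Proof. by move=> v [e [p [ep _ pa ev]]]; exists e, p. Qed.

Lemma rel_range_cons A a al : al != [::] ->
  rel_range A (a :: al) = rel_range (step A a) al.
Proof.
case: al => // b al _; apply/seteqP; split=> v.
  move=> [e [[|f p] [/= ep Ae]]] //; rewrite /path_label /= => -[ea fb pal] fv.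
  case/andP: ep => /eqP ef ep; exists f, p; split=> //.
    by apply/stepP; exists e.
  by rewrite /path_label /= fb pal.
move=> [f [p [ep /stepP[e [Ae ea ef]] fp fv]]]; exists e, (f :: p); split=> //=.
  by rewrite /follows ef eqxx.
by rewrite /path_label /= ea -fp.
Qed.

(** The relative range along a word, letter by letter. On the empty word it is
    A, whereas no path has the empty label. *)
Definition steps A al := foldl step A al.

Lemma rel_rangeE A al : al != [::] -> rel_range A al = steps A al.
Proof.
elim: al A => // a [|b al] IH A _ //.
by rewrite rel_range_cons// IH.
Qed.

Lemma steps_cat A al be : steps A (al ++ be) = steps (steps A al) be.
Proof. exact: foldl_cat. Qed.
Lemma steps_rcons A al a : steps A (rcons al a) = step (steps A al) a.
Proof. exact: foldl_rcons. Qed.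
Lemma calE_steps A al : calE A -> calE (steps A al).
Proof. by elim: al A => // a al IH A hA; apply: IH; exact: calE_step. Qed.
Lemma stepsS A B al : A `<=` B -> steps A al `<=` steps B al.
Proof. by elim: al A B => // a al IH A B AB; apply: IH; exact: stepS. Qed.

Lemma labeled_pathN0 al : labeled_path al -> al != [::].
Proof. by move=> [e [p [_ <-]]]. Qed.

(** All vertices of the class lie in the range of the label of an edge into v.
    Only finitely many words of length at most l end in that range, and the
    class is cut out of it by the ranges of these words. *)
Lemma calE_gen_vertex l (v : vertex G) : (1 <= l)%N -> non_source v ->
  calE (gen_vertex l v).
Proof.
move=> l1 [e ev]; pose a := lab e.
have rv : range_of [:: a] v by exists e, [::]; split.
have ra : calE (range_of [:: a]) by exact: calE_range (labeled_path1 a).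
pose cut (s : seq (seq (letter G))) : set (vertex G) :=
  [set w | range_of [:: a] w /\
  forall al, al \in s -> (range_of al w <-> range_of al v)].
have cutE s : (forall al, al \in s -> labeled_path al) -> calE (cut s).
  elim: s => [|al s IH] hs.
    rewrite (_ : cut [::] = range_of [:: a]); first exact: ra.
    by apply/seteqP; split=> w // [].
  have hcut : calE (cut s) by apply: IH => be bes; apply: hs;
    rewrite inE bes orbT.
  have hal : calE (range_of al) by apply: calE_range; apply: hs;
    rewrite inE eqxx.
  have [alv|alv] := pselect (range_of al v).
    rewrite (_ : cut (al :: s) = cut s `&` range_of al); first exact: calEI.
    apply/seteqP; split=> w.
      move=> [rw h]; split; first by split=> // be bes; apply: h;
        rewrite inE bes orbT.
      by apply/h => //; rewrite inE eqxx.
    by move=> [[rw h] alw]; split=> // be; rewrite inE => /orP[/eqP ->|/h].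
  rewrite (_ : cut (al :: s) = cut s `\` range_of al); first exact: calED.
  apply/seteqP; split=> w.
    move=> [rw h]; split; first by split=> // be bes; apply: h;
      rewrite inE bes orbT.
    by move=> /(h al (mem_head _ _)).
  by move=> [[rw h] alw]; split=> // be; rewrite inE => /orP[/eqP ->|/h].
have labelsE w al : labels_to l w al <-> range_of al w /\ (1 <= size al <= l)%N.
  split=> [[f [p [fp sz fw <-]]]|[[f [p [fp <- fw]]] sz]].
    by split; [exists f, p|rewrite size_map].
  by exists f, p; split=> //; move: sz; rewrite size_map.
pose S := \bigcup_(k in `I_l.+1)
  [set al | (1 <= k)%N /\ labels_into (range_of [:: a]) k al].
have finS : finite_set S.
  apply: bigcup_finite => // k _.
  have [k1|k0] := leqP 1 k.
    rewrite (_ : [set al | _] = labels_into (range_of [:: a]) k).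
      exact: (receiver_set_finite hG).
    by apply/seteqP; split=> al // [].
  by rewrite (_ : [set al | _] = set0)//; apply/seteqP; split=> al // [].
have [s sS] := (finite_seqP _).1 finS.
have sP al : al \in s <-> S al by rewrite sS.
have SP w al : range_of [:: a] w -> range_of al w -> (1 <= size al <= l)%N ->
  S al.
  move=> rw [f [p [fp <- fw]]] /andP[s1 s2]; exists (size (f :: p)).
    by rewrite /= ltnS; move: s2; rewrite size_map.
  by split=> //; exists f, p; rewrite fw.
have SL al : S al -> labeled_path al /\ (1 <= size al <= l)%N.
  move=> [k kl [k1 [f [p [fp sz fa <-]]]]]; split; first by exists f, p.
  by rewrite size_map sz k1 -ltnS.
rewrite (_ : gen_vertex l v = cut s); first by apply: cutE => al /sP/SL[].
apply/seteqP; split=> w.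
  move=> [_ lwv]; have rw : range_of [:: a] w.
    by apply: ((labelsE w [:: a]).1 _).1; rewrite lwv; apply/labelsE.
  split=> // al /sP/SL[_ sz]; split=> h.
    by apply: ((labelsE v al).1 _).1; rewrite -lwv; apply/labelsE.
  by apply: ((labelsE w al).1 _).1; rewrite lwv; apply/labelsE.
move=> [rw h]; split; first by case: rw => f [[|f' p] [//= _ _ fw]]; exists f.
apply/seteqP; split=> al /labelsE[ral sz]; apply/labelsE; split=> //.
  by apply/h => //; apply/sP/(SP w).
by apply/h => //; apply/sP/(SP v).
Qed.

End LabeledSpaceSets.

(** * Minimal sets of a quotient and their words *)

Section Quotient.
Variable G : labeled_graph.
Hypothesis hG : labeled_space G.
Variable H : set (set (vertex G)).
Hypotheses (Hher : hereditary H) (Hsat : saturated H).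
Implicit Types (A B C W : set (vertex G)) (a : letter G)
  (al be ga : seq (letter G)).

Lemma H_step A a : H A -> H (step A a).
Proof. by move=> hA; apply: (her_rel_range Hher) => //; exact: labeled_path1.
  Qed.
Lemma H_steps A al : H A -> H (steps A al).
Proof. by elim: al A => // a al IH A hA; apply: IH; exact: H_step. Qed.

Lemma ideal_relP A B : calE A -> calE B ->
  ideal_rel H A B <-> H (A `\` B) /\ H (B `\` A).
Proof.
move=> hA hB; split=> [[W HW AB]|[HAB HBA]].
  split; apply: (her_subset Hher HW); try exact: calED.
    move=> v [Av Bv]; have : (B `|` W) v by rewrite -AB; left.
    by case.
  move=> v [Bv Av]; have : (A `|` W) v by rewrite AB; left.
  by case.
exists ((A `\` B) `|` (B `\` A)); first exact: (herU Hher).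
apply/seteqP; split=> v [h|[[h n]|[h n]]].
- by have [Bv|Bv] := pselect (B v); [left|right; left].
- by right; left.
- by right; right.
- by have [Av|Av] := pselect (A v); [left|right; right].
- by right; left.
- by right; right.
Qed.

Lemma ideal_rel0 A : calE A -> ideal_rel H A set0 <-> H A.
Proof.
move=> hA; rewrite ideal_relP//; last exact: calE0.
by rewrite setD0 set0D; split=> [[]//|HA]; split=> //; exact: (her0 Hher).
Qed.

Lemma H_sub A B : H A -> calE B -> B `<=` A -> H B.
Proof. exact: (her_subset Hher). Qed.

Lemma calE_rel_range A al : calE A -> labeled_path al -> calE (rel_range A al).
Proof.
by move=> hA hal; rewrite rel_rangeE ?(labeled_pathN0 hal)//; exact: calE_steps.
Qed.

(** Nondegeneracy is saturation; a word whose range is in H has all its relative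
    ranges in H. *)
Lemma ideal_quotient : quotient_labeled_space (ideal_rel H).
Proof.
have Hrefl A : calE A -> ideal_rel H A A by exists set0 => //;
  exact: (her0 Hher).
split=> //.
- by move=> A B _ _ [W HW AB]; exists W.
- move=> A B C _ _ _ [W HW AB] [W' HW' BC]; exists (W `|` W').
    exact: (herU Hher).
  by rewrite setUA AB -setUA [W `|` _]setUC setUA BC -setUA.
- move=> A A' B B' hA hA' hB hB' [W HW AA'] [W' HW' BB']; exists (W `|` W').
    exact: (herU Hher).
  by rewrite setUACA AA' BB' setUACA.
- move=> A A' B B' hA hA' hB hB'.
  move=> /(ideal_relP hA hA')[h1 h2] /(ideal_relP hB hB')[h3 h4].
  apply/ideal_relP; [exact: calEI|exact: calEI|split].
    apply: (H_sub (herU Hher h1 h3)); first by apply: calED; exact: calEI.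
    move=> v [[Av Bv] n]; have [A'v|A'v] := pselect (A' v); last by left.
    by right; split=> // B'v; apply: n.
  apply: (H_sub (herU Hher h2 h4)); first by apply: calED; exact: calEI.
  move=> v [[Av Bv] n]; have [A'v|A'v] := pselect (A v); last by left.
  by right; split=> // B'v; apply: n.
- move=> A A' B B' hA hA' hB hB'.
  move=> /(ideal_relP hA hA')[h1 h2] /(ideal_relP hB hB')[h3 h4].
  apply/ideal_relP; [exact: calED|exact: calED|split].
    apply: (H_sub (herU Hher h1 h4)); first by apply: calED; exact: calED.
    move=> v [[Av Bv] n]; have [A'v|A'v] := pselect (A' v); last by left.
    by right; split=> //; apply: contrapT => B'v; apply: n.
  apply: (H_sub (herU Hher h2 h3)); first by apply: calED; exact: calED.
  move=> v [[Av Bv] n]; have [A'v|A'v] := pselect (A v); last by left.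
  by right; split=> //; apply: contrapT => B'v; apply: n.
- move=> A A' al hA hA' [hal _] /(ideal_relP hA hA')[h1 h2].
  apply/ideal_relP; try exact: calE_rel_range.
  have sub B B' : rel_range B al `\` rel_range B' al `<=` rel_range (B `\` B')
    al.
    move=> v [[e [p [ep Be pa ev]]] n]; exists e, p; split=> //; split=> // B'e.
    by apply: n; exists e, p.
  split; [apply: (H_sub (her_rel_range Hher h1 hal))|
    apply: (H_sub (her_rel_range Hher h2 hal))] => //;
    by apply: calED; exact: calE_rel_range.
- move=> A hA h; apply/ideal_rel0 => //; apply: Hsat => // al hal.
  have hr := calE_range hal.
  have [r0|r0] := pselect (H (range_of al)).
    by apply: (H_sub r0); [exact: calE_rel_range|exact: rel_range_range].
  apply/ideal_rel0; first exact: calE_rel_range.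
  by apply: h; split=> // /(ideal_rel0 hr).
- move=> A B al hA hB [hal _]; rewrite (weakly_left_resolving hG)//.
  by apply: Hrefl; apply: calE_rel_range => //; exact: calEI.
Qed.

(** The sets of calE whose classes are minimal in the quotient by H. *)
Definition minimal_mod A :=
  [/\ calE A, ~ H A & forall B, calE B -> H (A `\` B) \/ H (A `&` B)].

Lemma minimal_below (Hmin : has_minimal_structure (ideal_rel H)) A :
  calE A -> ~ H A -> exists2 B, minimal_mod B & B `<=` A.
Proof.
move=> hA nHA; have [|B [[hB nHB Bmin] BA]] := Hmin.1 A hA.
  by move=> /(ideal_rel0 hA).
have hBA := calEI hB hA.
have HBA : H (B `\` A).
  by move: BA => /(ideal_relP hBA hB)[_]; rewrite setDIr setDv set0U.
exists (B `&` A); last exact: subIsetr.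
split=> //.
  move=> HI; apply: nHB; apply/ideal_rel0 => //.
  by rewrite -(setUIDK B A); exact: (herU Hher).
move=> C hC; have hBC := calEI hB hC; case: (Bmin C hC).
  move=> /(ideal_relP hBC hB)[_]; rewrite setDIr setDv set0U => h; left.
  by apply: (H_sub h); [exact: calED|exact: setSD].
move=> /(ideal_rel0 hBC) h; right; apply: (H_sub h); first exact: calEI.
by apply: setSI.
Qed.

(** Saturation and heredity: otherwise all relative ranges of A are in H. *)
Lemma emits_letter A : calE A -> ~ H A -> exists a, ~ H (step A a).
Proof.
move=> hA nHA; apply: contrapT => h; apply: nHA; apply: Hsat => // -[|a al] hal.
  by have := labeled_pathN0 hal.
rewrite rel_rangeE//=; apply: H_steps; apply: contrapT => nH.
by apply: h; exists a.
Qed.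

Lemma emits_word A n : calE A -> ~ H A ->
  exists2 al, size al = n & ~ H (steps A al).
Proof.
move=> hA nHA; elim: n => [|n [al sz nH]]; first by exists [::].
have [a nHa] := emits_letter (calE_steps al hA) nH.
by exists (rcons al a); rewrite ?size_rcons ?sz// steps_rcons.
Qed.

Lemma minimal_follow (Hmin : has_minimal_structure (ideal_rel H)) A n :
  minimal_mod A -> exists al B,
    [/\ size al = n, minimal_mod B & B `<=` steps A al].
Proof.
move=> Am; elim: n => [|n [al [B [sz Bm BA]]]]; first by exists [::], A; split.
have [hB nHB _] := Bm; have [a nHa] := emits_letter hB nHB.
have [C Cm CB] := minimal_below Hmin (calE_step a hB) nHa.
exists (rcons al a), C; split=> //; first by rewrite size_rcons sz.
by rewrite steps_rcons; apply: (subset_trans CB); exact: stepS.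
Qed.

Definition has_period (q : nat) al := forall a0 i,
  (i + q < size al)%N -> nth a0 al (i + q) = nth a0 al i.

Lemma has_period_mul q k al : has_period q al -> has_period (k * q) al.
Proof.
move=> qal a0; elim: k => [|k IH] i; first by rewrite mul0n addn0.
rewrite mulSn addnCA addnA => h; rewrite [(q + i)%N]addnC in h *.
rewrite addnAC qal; first by rewrite IH// (leq_ltn_trans _ h)// addnAC leq_addr.
by rewrite addnAC.
Qed.

(** Comparing al = be ++ al' and al = al' ++ ga position by position. *)
Lemma overlap_period be al' ga al : al = be ++ al' -> al = al' ++ ga ->
  size be = size ga -> has_period (size be) al.
Proof.
move=> E1 E2 sz a0 i h; rewrite {1}E1 nth_cat ltnNge leq_addl /= addnK E2
  nth_cat.
suff -> : (i < size al')%N by [].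
by move: h; rewrite E1 size_cat addnC ltn_add2l.
Qed.

(** The common period l`! replaces the periods at most l, which depend on the
    word. *)
Lemma agreeable_periodic l v : (1 <= l)%N -> non_source v ->
  ~ disagreeable_class (ideal_rel H) l v ->
  exists n, forall al, (n <= size al)%N -> ~ H (steps (gen_vertex l v) al) ->
    has_period l`! al.
Proof.
move=> l1 v1 ndis.
have [n nP] : exists n, forall al, (n <= size al)%N ->
    ~ disagreeable_path (ideal_rel H) l v al.
  apply: contrapT => h; apply: ndis; exists 1%N => // n _.
  apply: contrapT => h'; apply: h; exists n => al szal dal.
  by apply: h'; exists al.
have hV := calE_gen_vertex hG l1 v1.
exists n.+1 => al szal nH.
have al0 : al != [::] by case: (al) szal.
have labal : labeled_path al.
  have : rel_range (gen_vertex l v) al !=set0.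
    apply/set0P/eqP => h; apply: nH; rewrite -rel_rangeE// h;
      exact: (her0 Hher).
  by move=> [w [e [p [ep _ pa _]]]]; exists e, p.
have := nP al (ltnW szal); rewrite /disagreeable_path.
apply: contra_notP => nper; split.
- split=> // /(ideal_rel0 (calE_range labal)) h; apply: nH.
  rewrite -rel_rangeE//; apply: (H_sub h); last exact: rel_range_range.
  exact: calE_rel_range.
- move=> /ideal_rel0 h; apply: nH; rewrite -rel_rangeE//; apply: h.
  exact: calE_rel_range.
- move=> [be [al' [ga [_ [lbe _] _ [E1 E2 sz szl]]]]]; apply: nper.
  have be0 : (0 < size be)%N by have := labeled_pathN0 lbe; case: (be).
  have /dvdnP[k ->] : (size be %| l`!)%N by rewrite dvdn_fact// be0.
  by apply: has_period_mul; exact: overlap_period E1 E2 sz.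
Qed.

(** Follow minimal sets from one below the given class along a word al of length
    l`!. Whatever the minimal set A reached there emits can be prolonged to a
    long word, which prolongs al to a long word emitted by the class. This one
    has period l`!, so al determines it. *)
Lemma unique_word (Hmin : has_minimal_structure (ideal_rel H)) l v :
  (1 <= l)%N -> non_source v -> ~ ideal_rel H (gen_vertex l v) set0 ->
  ~ disagreeable_class (ideal_rel H) l v ->
  exists A (L : nat) (om : nat -> letter G), [/\ minimal_mod A, (0 < L)%N,
    forall i, om (i + L)%N = om i
    & forall al, ~ H (steps A al) -> al = mkseq om (size al)].
Proof.
move=> l1 v1 nH0 ndis; have hV := calE_gen_vertex hG l1 v1.
have nHV : ~ H (gen_vertex l v) by move=> /ideal_rel0 h; apply: nH0; apply: h.
have [n per] := agreeable_periodic l1 v1 ndis.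
have [A1 A1m A1V] := minimal_below Hmin hV nHV.
have [al [A [szal Am AA1]]] := minimal_follow Hmin l`! A1m.
have [e ev] := v1; pose a0 := lab e; have L0 := fact_gt0 l.
pose om i := nth a0 al (i %% l`!).
exists A, l`!, om; split=> //; first by move=> i; rewrite /om modnDr.
have [hA nHA _] := Am.
move=> ga nHga; have [de szde nHde] := emits_word n (calE_steps ga hA) nHga.
(* al comes from the class, ga from A, and de makes the word long enough. *)
set w := al ++ ga ++ de.
have pw : has_period l`! w.
  apply: per; first by rewrite /w !size_cat szde !addnA leq_addl.
  move=> Hw; apply: nHde; apply: (H_sub Hw).
    by apply: calE_steps; exact: calE_steps.
  rewrite /w !steps_cat; do 2 apply: stepsS.
  by apply: (subset_trans AA1); exact: stepsS.
have wom i : (i < size w)%N -> nth a0 w i = om i.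
  move=> iw; rewrite {1}(divn_eq i l`!) addnC (has_period_mul pw); last first.
    by rewrite addnC -divn_eq.
  by rewrite /w nth_cat szal ltn_pmod.
apply: (@eq_from_nth _ a0); first by rewrite size_mkseq.
move=> i iga; rewrite nth_mkseq//.
have : nth a0 w (l`! + i) = nth a0 ga i.
  by rewrite /w nth_cat szal ltnNge leq_addr /= addKn nth_cat iga.
move=> <-; rewrite wom; first by rewrite /om modnDl.
by rewrite /w !size_cat szal ltn_add2l ltn_addr.
Qed.
End Quotient.

(** * Decorated infinite words *)

Section Points.
Variable G : labeled_graph.
Hypothesis hG : labeled_space G.
Variable H : set (set (vertex G)).
Hypotheses (Hher : hereditary H) (Hsat : saturated H).
Implicit Types (A B C : set (vertex G)) (a : letter G) (al : seq (letter G)).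
Implicit Types (F : set (set (vertex G))).

(** The nonempty ones are the ultrafilters of the Boolean ring calE / H; the
    empty one arises by pulling back along an edge that starts in no set of
    calE. Infinite words alone do not separate the paths over a minimal set;
    with filters they do. *)
Record prime_filter F : Prop := PrimeFilter {
  pf_calE : forall B, F B -> calE B;
  pf_proper : forall B, F B -> ~ H B;
  pfI : forall B C, calE B -> calE C -> F (B `&` C) <-> F B /\ F C;
  pfU : forall B C, calE B -> calE C -> F (B `|` C) <-> F B \/ F C
}.

Lemma pf_up F A B : prime_filter F -> F A -> calE B -> A `<=` B -> F B.
Proof.
move=> Fp FA hB AB; have hA := pf_calE Fp FA.
by apply: ((pfI Fp hA hB).1 _).2; rewrite (_ : A `&` B = A)//; exact/setIidPl.
Qed.

(** The only filter from which the letter a can lead to F: relative ranges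
    preserve intersections, so the labeled space is left-resolving on filters. *)
Definition pullback a F := [set B | calE B /\ F (step B a)].

Lemma pullback_prime a F : prime_filter F -> prime_filter (pullback a F).
Proof.
move=> Fp; split.
- by move=> B [].
- by move=> B [hB FB] HB; apply: (pf_proper Fp FB); exact: H_step.
- move=> B C hB hC; rewrite /pullback /= stepI//.
  have := pfI Fp (calE_step a hB) (calE_step a hC).
  by have := calEI hB hC; tauto.
- move=> B C hB hC; rewrite /pullback /= stepU.
  have := pfU Fp (calE_step a hB) (calE_step a hC).
  by have := calEU hB hC; tauto.
Qed.

(** The principal filter of a minimal set. *)
Definition filter_of A := [set B | calE B /\ ~ H (A `&` B)].

Lemma filter_of_prime A : minimal_mod H A -> prime_filter (filter_of A).
Proof.
move=> [hA nHA Am]; have HU B C : H B -> H C -> H (B `|` C) by exact: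
  (herU Hher).
split.
- by move=> B [].
- move=> B [hB nH] HB; apply: nH; apply: (H_sub Hher HB); first exact: calEI.
  exact: subIsetr.
- move=> B C hB hC; split.
    move=> [hBC nH]; split; split=> // h; apply: nH.
      apply: (H_sub Hher h); first exact: calEI.
      by rewrite setIA; exact: subIsetl.
    apply: (H_sub Hher h); first exact: calEI.
    by rewrite [B `&` C]setIC setIA; exact: subIsetl.
  move=> [[_ nB] [_ nC]]; split; first exact: calEI.
  move=> nBC; have [HB|//] := Am B hB; have [HC|//] := Am C hC.
  apply: nHA; apply: (H_sub Hher (HU _ _ (HU _ _ HB HC) nBC) hA) => v Av.
  have [Bv|Bv] := pselect (B v); last by left; left.
  have [Cv|Cv] := pselect (C v); last by left; right.
  by right.
- move=> B C hB hC; rewrite /filter_of /= setIUr; split.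
    move=> [_ nH]; apply: contrapT => /not_orP[n1 n2]; apply: nH; apply: HU.
      by apply: contrapT => h; apply: n1.
    by apply: contrapT => h; apply: n2.
  move=> h; split; first exact: calEU.
  move=> Hh; have sub D : calE D -> A `&` D `<=` A `&` B `|` A `&` C ->
    H (A `&` D).
    by move=> hD; apply: H_sub => //; exact: calEI.
  by case: h => -[_ nH]; apply: nH; apply: sub.
Qed.

Lemma filter_of_self A : minimal_mod H A -> filter_of A A.
Proof. by move=> [hA nHA _]; split=> //; rewrite setIid. Qed.

(** A minimal set lies in one prime filter only: modulo H, any B of calE either
    contains it or misses it. *)
Lemma prime_filter_minimal F A : minimal_mod H A -> prime_filter F -> F A ->
  F = filter_of A.
Proof.
move=> [hA nHA Am] Fp FA; apply/seteqP; split=> B.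
  move=> FB; have hB := pf_calE Fp FB; split=> //.
  by apply: (pf_proper Fp); apply/(pfI Fp).
move=> [hB nH]; have [HD|//] := Am B hB.
have := FA; rewrite -(setUIDK A B) => /(pfU Fp (calEI hA hB) (calED hA hB))[].
  by move=> /(pfI Fp hA hB)[].
by move=> /(pf_proper Fp).
Qed.

Lemma filter_of_pullback A B a : minimal_mod H A -> minimal_mod H B ->
  B `<=` step A a -> filter_of A = pullback a (filter_of B).
Proof.
move=> Am Bm BA; apply/esym/prime_filter_minimal => //.
  exact/pullback_prime/filter_of_prime.
have [hA _ _] := Am; have [hB nHB _] := Bm.
split=> //; split; first exact: calE_step.
by rewrite (_ : B `&` _ = B)//; exact/setIidPl.
Qed.

Definition point := nat -> letter G * set (set (vertex G)).
Implicit Types (x y z : point).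

(** The infinite paths of the left-resolving graph of prime filters. *)
Definition coherent y := forall n,
  prime_filter (y n).2 /\ (y n).2 = pullback (y n).1 (y n.+1).2.

Definition shift_point y k : point := fun n => y (k + n)%N.

Definition pcons a y : point :=
  fun n => if n is m.+1 then y m else (a, pullback a (y 0%N).2).

Lemma shift_coherent y k : coherent y -> coherent (shift_point y k).
Proof. by move=> yc n; rewrite /shift_point addnS; exact: yc. Qed.

Lemma pcons_coherent a y : coherent y -> coherent (pcons a y).
Proof.
move=> yc [|n] /=; last exact: yc.
by split=> //; apply: pullback_prime; exact: (yc 0%N).1.
Qed.

Lemma pcons_shift y : coherent y -> pcons (y 0%N).1 (shift_point y 1) = y.
Proof.
move=> yc; apply/funext => -[|n] /=; last by rewrite /shift_point add1n.
by rewrite {3}[y 0%N]surjective_pairing (yc 0%N).2.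
Qed.

Lemma coherent_steps y A : coherent y -> (y 0%N).2 A ->
  forall n, (y n).2 (steps A (mkseq (fun i => (y i).1) n)).
Proof.
move=> yc yA; elim=> [|n IH] //.
by rewrite mkseqS steps_rcons; move: IH; rewrite (yc n).2 => -[].
Qed.

Lemma coherent_exists (Hmin : has_minimal_structure (ideal_rel H)) A :
  minimal_mod H A -> exists2 y, coherent y & (y 0%N).2 = filter_of A.
Proof.
move=> Am; pose T := {B | minimal_mod H B}.
have next (B : T) : exists s : letter G * T,
    projT1 s.2 `<=` step (projT1 B) s.1.
  case: B => B Bm /=; have [hB nHB _] := Bm.
  have [a nHa] := emits_letter Hher Hsat hB nHB.
  have [C Cm CB] := minimal_below Hher Hmin (calE_step a hB) nHa.
  by exists (a, exist _ C Cm).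
have [f fP] := boolp.choice next.
pose B := fix B n : T := if n is m.+1 then (f (B m)).2 else exist _ A Am.
exists (fun n => ((f (B n)).1, filter_of (projT1 (B n)))) => // n /=; split.
  exact/filter_of_prime/(projT2 (B n)).
apply: filter_of_pullback; [exact: (projT2 (B n))| |exact: fP].
exact: (projT2 (f (B n)).2).
Qed.

Section UniqueWord.
Hypothesis Hmin : has_minimal_structure (ideal_rel H).
Variables (A : set (vertex G)) (L : nat) (om : nat -> letter G).
Hypotheses (Am : minimal_mod H A) (L0 : (0 < L)%N)
  (omL : forall i, om (i + L)%N = om i)
  (omP : forall al, ~ H (steps A al) -> al = mkseq om (size al)).

Lemma word_unique y : coherent y -> (y 0%N).2 = filter_of A ->
  forall n, (y n).1 = om n.
Proof.
move=> yc y0 n; have yA : (y 0%N).2 A by rewrite y0; exact: filter_of_self.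
have := omP (pf_proper (yc n.+1).1 (coherent_steps yc yA n.+1)).
rewrite size_mkseq => /(congr1 (nth (om n) ^~ n)).
by rewrite !nth_mkseq.
Qed.

(** Both points read the periodic word om. If om agrees from some position on
    with its shift by k - j, it does so everywhere, and letters determine how
    filters are pulled back. *)
Lemma coincide_back x y : coherent x -> coherent y ->
  (x 0%N).2 = filter_of A -> (y 0%N).2 = filter_of A ->
  forall t k j, (forall n, y (k + t + n)%N = x (j + t + n)%N) ->
  forall n, y (k + n)%N = x (j + n)%N.
Proof.
move=> xc yc x0 y0; have wx := word_unique xc x0; have wy := word_unique yc y0.
elim=> [|t IH] k j h; first by move=> n; have := h n; rewrite !addn0.
apply: IH => -[|n]; last by have := h n; rewrite !addnS !addSn.
rewrite !addn0 [LHS]surjective_pairing [RHS]surjective_pairing.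
have letterE : (y (k + t)%N).1 = (x (j + t)%N).1.
  (* By periodicity it suffices to compare the letters one period later. *)
  have := h L.-1; rewrite !addnS !addSn -!addnS prednK// => /(congr1 fst).
  by rewrite wx wy !omL wx wy.
congr pair => //; rewrite (yc _).2 (xc _).2 letterE.
by have := h 0%N; rewrite !addn0 !addnS => ->.
Qed.

Definition returns c := (0 < c)%N /\ exists z,
  [/\ coherent z, (z 0%N).2 = filter_of A & (z c).2 = filter_of A].

(** If no point over A returns to the filter of A, any point x over A works: a
    point y over A with y (k + n) = x (j + n) for all n has k = j, as going back
    exhibits a return for k <> j. Otherwise let x go for ever round the loop
    given by a shortest return, of length c. Then k - j can be replaced with its
    residue d modulo c, and y returns at time d < c, whence d = 0. *)
Lemma isolated_point : exists x, [/\ coherent x, (x 0%N).2 = filter_of A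
  & forall y, coherent y -> (y 0%N).2 = filter_of A ->
    (exists k j, forall n, y (k + n)%N = x (j + n)%N) -> y = x].
Proof.
have [[c rc]|nret] := pselect (exists c, returns c); last first.
  have [x xc x0] := coherent_exists Hmin Am; exists x; split=> //.
  move=> y yc y0 [k [j h]]; apply/funext => n.
  have back := coincide_back xc yc x0 y0.
  have [kj|jk|kj] := ltngtP k j.
  - case: nret; exists (j - k)%N; split; first by rewrite subn_gt0.
    exists x; split=> //; rewrite -y0.
    have := back k 0%N (j - k)%N; rewrite add0n subnK ?(ltnW kj)//.
    by move=> /(_ h 0%N); rewrite !addn0 => ->.
  - case: nret; exists (k - j)%N; split; first by rewrite subn_gt0.
    exists y; split=> //; rewrite -x0.
    have := back j (k - j)%N 0%N; rewrite add0n subnK ?(ltnW jk)//.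
    by move=> /(_ h 0%N); rewrite !addn0 => ->.
  - by have := back k 0%N 0%N; rewrite !add0n => /(_ _ n); rewrite !add0n;
      apply; rewrite {2}kj.
have exc : exists c, `[< returns c >] by exists c; exact/asboolP.
case: (ex_minnP exc) => {rc}c /asboolP[c0 [z [zc z0 zc0]]] cmin.
pose x : point := fun n => z (n %% c)%N.
have xc : coherent x.
  move=> n; split; first exact: (zc _).1.
  rewrite /x (zc _).2; congr (pullback _ _).
  have := ltn_pmod n c0; rewrite leq_eqVlt => /orP[/eqP e|lt].
    by rewrite e (_ : n.+1 %% c = 0)%N ?z0 ?zc0// -addn1 -modnDml addn1 e modnn.
  by rewrite (_ : n.+1 %% c = (n %% c).+1)%N// -addn1 -modnDml addn1 modn_small.
have x0 : (x 0%N).2 = filter_of A by rewrite /x mod0n.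
exists x; split=> // y yc y0 [k [j h]].
have back := coincide_back xc yc x0 y0.
(* d is the residue of k - j modulo c, written without subtraction. *)
pose d := ((k + j * c.-1) %% c)%N.
have djk : j + d = k %[mod c].
  rewrite /d modnDmr addnCA -mulnS prednK// addnC modnMDl//.
have xjk n : x (j + d + n)%N = x (k + n)%N.
  by rewrite /x -modnDml djk modnDml.
have yd n : y (d + n)%N = x n.
  have := back k d 0%N; rewrite add0n => /(_ _ n) ->; first by rewrite add0n.
  by move=> m; rewrite -xjk [(d + k)%N]addnC -!addnA h.
apply/funext => n; rewrite -(yd n); congr (y _).
have [->//|d0] := posnP d.
have /cmin : `[< returns d >].
  apply/asboolP; split=> //; exists y; split=> //.
  by rewrite -x0 -(yd 0%N) addn0.
by rewrite leqNgt /d ltn_pmod.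
Qed.
End UniqueWord.
End Points.

(** * The representation on an orbit *)

Record point_pbij (G : labeled_graph) := PointPbij {
  ppb :> point G -> point G -> Prop;
  ppb_fun : forall x y y', ppb x y -> ppb x y' -> y = y';
  ppb_inj : forall x x' y, ppb x y -> ppb x' y -> x = x'
}.

Section OrbitRepresentation.
Variables (R : realType) (G : labeled_graph).
Hypothesis hG : labeled_space G.
Variable H : set (set (vertex G)).
Hypothesis (Hher : hereditary H).
Variable x0 : point G.
Hypothesis x0c : coherent H x0.
Implicit Types (A B C : set (vertex G)) (a b : letter G) (al : seq (letter G)).
Implicit Types (x y z : point G) (r : point_pbij G).

(** A finite word prepended to a tail of x0: the coherent points that share a
    tail with x0 are of this form, so there are countably many. *)
Definition orbit_point (c : seq (letter G) * nat) : point G :=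
  foldr (@pcons G) (shift_point x0 c.2) c.1.

Definition in_orbit y := exists c, y = orbit_point c.

Lemma orbit_coherent y : in_orbit y -> coherent H y.
Proof.
move=> [[al j] ->]; elim: al => [|a al IH]; first exact: shift_coherent.
exact: pcons_coherent.
Qed.

Lemma orbit_pcons a y : in_orbit y -> in_orbit (pcons a y).
Proof. by move=> [[al j] ->]; exists (a :: al, j). Qed.

Lemma orbit_shift y : in_orbit y -> in_orbit (shift_point y 1).
Proof.
move=> [[[|a al] j] ->]; last by exists (al, j).
by exists ([::], j.+1); apply/funext => n;
  rewrite /orbit_point /shift_point /= addnA addn1.
Qed.

Lemma orbit_base : in_orbit x0.
Proof. by exists ([::], 0%N). Qed.

Lemma orbit_lag y : in_orbit y -> exists k j, forall n, y (k + n)%N = x0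
  (j + n)%N.
Proof.
move=> [[al j] ->]; exists (size al), j => n.
by elim: al => // a al IH.
Qed.

(** An injective numbering of the orbit, to index basis vectors. *)
Definition code y : nat :=
  if pselect (in_orbit y) is left h then pickle (projT1 (cid h)) else 0%N.

Lemma code_inj y z : in_orbit y -> in_orbit z -> code y = code z -> y = z.
Proof.
rewrite /code => oy oz; case: pselect => // h; case: pselect => // h'.
by case: cid => c /= ->; case: cid => c' /= -> /(pcan_inj pickleK) ->.
Qed.

Definition coded_pbij r : pbij.
Proof.
refine (@PBij (fun n m => exists y z,
  [/\ in_orbit y, in_orbit z, code y = n, code z = m & r y z]) _ _).
- move=> n m m' [y [z [oy oz yn <- yz]]] [y' [z' [oy' oz' yn' <- yz']]].
  have yy' : y = y' by apply: code_inj => //; rewrite yn.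
  by rewrite (ppb_fun yz (_ : r y z'))// yy'.
- move=> n n' m [y [z [oy oz <- zm yz]]] [y' [z' [oy' oz' <- zm' yz']]].
  have zz' : z = z' by apply: code_inj => //; rewrite zm.
  by rewrite (ppb_inj yz (_ : r y' z))// zz'.
Defined.

Lemma coded_pbijE r y z : in_orbit y -> in_orbit z ->
  coded_pbij r (code y) (code z) <-> r y z.
Proof.
move=> oy oz; split=> [[y' [z' [oy' oz' /code_inj <-// /code_inj <-//]]]|yz].
by exists y, z.
Qed.

Definition orbit_op r : op_cstar (l2_hilbert R) := pbop R (coded_pbij r).

Lemma orbit_op_val r (u : l2 R) y z : in_orbit y -> in_orbit z -> r y z ->
  (orbit_op r : op _) u (code z) = u (code y).
Proof. by move=> oy oz yz; apply: pushE; apply/coded_pbijE. Qed.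

Lemma orbit_op_val0 r (u : l2 R) m :
  (forall y z, in_orbit y -> in_orbit z -> code z = m -> ~ r y z) ->
  (orbit_op r : op _) u m = 0.
Proof. by move=> h; apply: push0 => n [y [z [oy oz _ zm yz]]]; exact: (h y z).
  Qed.

Definition ppbV r : point_pbij G :=
  @PointPbij G (fun y z => r z y) (fun x y y' => @ppb_inj G r y y' x)
    (fun x x' y => @ppb_fun G r y x x').

Definition ppbM r r' : point_pbij G.
Proof.
refine (@PointPbij G (fun y z => exists2 w, in_orbit w & r' y w /\ r w z) _ _).
- move=> x y y' [w ow [xw wy]] [w' ow' [xw' wy']].
  by apply: ppb_fun wy _; rewrite (ppb_fun xw xw').
- move=> x x' y [w ow [xw wy]] [w' ow' [xw' wy']].
  by apply: ppb_inj xw _; rewrite (ppb_inj wy wy').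
Defined.

Lemma eq_orbit_op r r' : (forall y z, in_orbit y -> in_orbit z -> r y z <->
  r' y z) -> orbit_op r = orbit_op r'.
Proof.
move=> rr'; apply: eq_pbop => n m.
by split=> -[y [z [oy oz yn zm yz]]]; exists y, z; split=> //; apply/rr'.
Qed.

Lemma orbit_op_adj r : adj (orbit_op r) = orbit_op (ppbV r).
Proof.
rewrite /orbit_op /= pbop_adj; apply: eq_pbop => n m.
by split=> -[y [z [oy oz yn zm yz]]]; exists z, y.
Qed.

Lemma orbit_op_mul r r' : orbit_op r ** orbit_op r' = orbit_op (ppbM r r').
Proof.
rewrite /orbit_op /= pbop_mul; apply: eq_pbop => n m; split.
  move=> [k [y [w [oy ow yn wk yw]]] [w' [z [ow' oz wk' zm wz]]]].
  have ww' : w = w' by apply: code_inj => //; rewrite wk.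
  by exists y, z; split=> //; exists w => //; rewrite {2}ww'.
move=> [y [z [oy oz yn zm [w ow [yw wz]]]]]; exists (code w).
  by exists y, w.
by exists w, z.
Qed.

Lemma orbit_op_0 r : (forall y z, in_orbit y -> in_orbit z -> ~ r y z) ->
  orbit_op r = 0.
Proof.
by move=> h; apply: pbop_0 => n m [y [z [oy oz _ _ yz]]]; exact: (h y z).
Qed.

Definition proj_ppb A : point_pbij G.
Proof.
refine (@PointPbij G (fun y z => (y 0%N).2 A /\ z = y) _ _).
- by move=> x y y' [_ ->] [_ ->].
- by move=> x x' y [_ ->] [_ ->].
Defined.

Definition letter_ppb a : point_pbij G.
Proof.
refine (@PointPbij G (fun y z => (y 0%N).2 (range_of [:: a]) /\ z = pcons a y) _
  _).
- by move=> x y y' [_ ->] [_ ->].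
- move=> x x' y [_ ->] [_ e]; apply/funext => n.
  by have := congr1 (fun w : point G => w n.+1) e.
Defined.

Definition orbit_proj A := orbit_op (proj_ppb A).
Definition orbit_letter a := orbit_op (letter_ppb a).

Lemma orbit_filter y : in_orbit y -> prime_filter H (y 0%N).2.
Proof. by move=> /orbit_coherent/(_ 0%N)[]. Qed.

Lemma proj_val A (u : l2 R) y : in_orbit y ->
  (orbit_proj A : op _) u (code y) = if `[< (y 0%N).2 A >] then u (code y) else
    0.
Proof.
move=> oy; case: ifPn => [/asboolP yA|/asboolP yA]; first exact: orbit_op_val.
apply: orbit_op_val0 => w z ow oz zy [wA zw]; apply: yA.
by rewrite -(code_inj oz oy zy) zw.
Qed.

Lemma proj_val0 A (u : l2 R) m : (forall y, in_orbit y -> code y <> m) ->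
  (orbit_proj A : op _) u m = 0.
Proof. by move=> h; apply: orbit_op_val0 => w z _ oz zm; have := h z oz. Qed.

Lemma code_case m : (exists2 y, in_orbit y & code y = m) \/
  (forall y, in_orbit y -> code y <> m).
Proof.
have [h|h] := pselect (exists2 y, in_orbit y & code y = m); [by left|right].
by move=> y oy ym; apply: h; exists y.
Qed.

Lemma fsum_opE (I : choiceType) (X : set I) (F : I -> op (l2_hilbert R))
  (u : l2 R) m :
  finite_set X -> (\sum_(i \in X) F i) u m = \sum_(i \in X) (F i u m).
Proof.
move=> fX; rewrite !fsbig_finite//=.
by elim/big_ind2: _ => // x1 x2 y1 y2 <- <-.
Qed.

Lemma letters_from_finite A : calE A -> finite_set (letters_from A).
Proof.
move=> hA; have fin := set_finite hG hA (leqnn 1).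
have [[a0 _]|n0] := pselect (exists a : letter G, True); last first.
  by rewrite (_ : letters_from A = set0)//; apply/seteqP; split=> a //;
    case: n0; exists a.
apply: (@sub_finite_set _ _ (head a0 @` labels_from A 1));
  last exact: finite_image.
by move=> a [e Ae ea]; exists [:: a] => //; exists e, [::]; split=> //;
  rewrite /path_label /= ea.
Qed.

(** All relations but finite additivity and the last one compare graphs of
    partial bijections. Those two are checked on coordinates; the last one says
    that a point over A is obtained in one way by prepending a letter to a point
    over a relative range of A. *)
Lemma orbit_representation : representation orbit_letter orbit_proj.
Proof.
split.
- move=> A hA; split.
    rewrite orbit_op_adj; apply: eq_orbit_op => y z oy oz /=.
    by split=> -[yA e]; rewrite e in yA *.
  rewrite orbit_op_mul; apply: eq_orbit_op => y z oy oz /=; split.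
    by move=> [w ow [[yA ->] [_ ->]]].
  by move=> [yA ->]; exists y.
- move=> a; rewrite /is_partial_isometry orbit_op_adj !orbit_op_mul;
    apply: eq_orbit_op => y z oy oz /=; split.
    move=> [w ow [[ya wE] [v ov [[va wv] [va' zv]]]]]; split=> //.
    by rewrite zv -wv.
  move=> [ya ->]; exists (pcons a y); first exact: orbit_pcons.
  by split=> //; exists y.
- apply: orbit_op_0 => y z oy oz [y0 _].
  by apply: (pf_proper (orbit_filter oy) y0); exact: (her0 Hher).
- move=> A B hA hB; rewrite orbit_op_mul; apply: eq_orbit_op => y z oy oz /=.
  rewrite (pfI (orbit_filter oy) hA hB); split.
    by move=> [[yA yB] ->]; exists y.
  by move=> [w ow [[yB ->] [yA ->]]].
- move=> A B hA hB; apply: op_eq => u; apply: l2_eq => m.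
  rewrite opBE opDE l2BE l2DE.
  have [[y oy <-]|nc] := code_case m; last by rewrite !proj_val0// subr0 addr0.
  rewrite !proj_val//.
  have := pfU (orbit_filter oy) hA hB; have := pfI (orbit_filter oy) hA hB.
  have [yA|yA] := asboolP ((y 0%N).2 A); have [yB|yB] := asboolP ((y 0%N).2 B);
  have [yI|yI] := asboolP ((y 0%N).2 (A `&` B));
    have [yU|yU] := asboolP ((y 0%N).2 (A `|` B));
  rewrite ?subr0 ?addr0 ?add0r ?addrK ?subrr//; tauto.
- move=> A a hA; rewrite !orbit_op_mul; apply: eq_orbit_op => y z oy oz /=.
  have up : (y 0%N).2 (step A a) -> (y 0%N).2 (range_of [:: a]).
    move=> h; apply: (pf_up (orbit_filter oy) h); last exact: step_range.
    exact: (calE_range (labeled_path1 a)).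
  split.
    by move=> [w ow [[ya ->] [[_ yA] ->]]]; exists y => //; split=> //;
      split=> //; exact: up.
  by move=> [w ow [[yA ->] [ya ->]]]; exists (pcons a y); [exact: orbit_pcons|].
- move=> a; rewrite orbit_op_adj orbit_op_mul;
    apply: eq_orbit_op => y z oy oz /=; split.
    move=> [w ow [[ya wE] [za wE']]]; split=> //.
    apply/funext => n; have := congr1 (fun w : point G => w n.+1) wE'.
    by rewrite wE.
  by move=> [ya ->]; exists (pcons a y); first exact: orbit_pcons.
- move=> a b ab; rewrite orbit_op_adj orbit_op_mul;
    apply: orbit_op_0 => y z oy oz /= [w ow [[_ wE] [_ wE']]].
  by apply: ab; have := congr1 (fun w : point G => (w 0%N).1) wE'; rewrite wE.
- move=> A hA; apply: op_eq => u; apply: l2_eq => m.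
  rewrite fsum_opE; last exact: letters_from_finite.
  have termE a : orbit_letter a ** orbit_proj (rel_range A [:: a]) ** adj
    (orbit_letter a) =
      orbit_op (ppbM (ppbM (letter_ppb a) (proj_ppb (step A a)))
        (ppbV (letter_ppb a))).
    by rewrite orbit_op_adj !orbit_op_mul.
  have val0 a y : in_orbit y -> ((y 0%N).1 <> a \/ ~ (y 0%N).2 A) ->
      (orbit_letter a ** orbit_proj (rel_range A [:: a]) ** adj (orbit_letter a)
        : op _) u (code y) = 0.
    move=> oy h; rewrite termE; apply: orbit_op_val0 => w z ow oz zy /=.
    move=> [v ov [[va wv] [v' ov' [[vA v'v] [_ zv']]]]].
    move: zv'; rewrite v'v (code_inj oz oy zy) => yE.
    case: h; rewrite yE //=; apply; split=> //.
  have [[y oy <-]|nc] := code_case m; last first.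
    rewrite proj_val0// fsbig1// => a _; rewrite termE.
    by apply: orbit_op_val0 => w z _ oz zm; have := nc z oz.
  rewrite proj_val//; case: asboolP => [yA|yA]; last first.
    by rewrite fsbig1// => a _; apply: val0 => //; right.
  have yc := orbit_coherent oy; pose a := (y 0%N).1; pose w := shift_point y 1.
  have ow : in_orbit w by exact: orbit_shift.
  have yE : y = pcons a w by rewrite (pcons_shift yc).
  have wA : (w 0%N).2 (step A a) by move: yA; rewrite (yc 0%N).2 => -[].
  have aA : letters_from A a.
    apply: contrapT => na; apply: (pf_proper (orbit_filter ow) wA).
    rewrite (_ : step A a = set0); first exact: (her0 Hher).
    apply/seteqP; split=> v // /stepP[e [Ae ea _]]; apply: na; by exists e.
  rewrite (fsbigD1 a)//; last exact: letters_from_finite.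
  rewrite fsbig1 ?addr0; last first.
    by move=> b [_ ba]; apply: val0 => //; left => ab; apply: ba;
      rewrite /= -ab.
  rewrite termE (@orbit_op_val _ u y y)//= ?addr0//; exists w => //; split.
    split=> //; apply: (pf_up (orbit_filter ow) wA); last exact: step_range.
    exact: (calE_range (labeled_path1 a)).
  exists w => //; split=> //; split=> //.
  apply: (pf_up (orbit_filter ow) wA); last exact: step_range.
  exact: (calE_range (labeled_path1 a)).
Qed.

End OrbitRepresentation.

(** * Vector states on the square-summable sequences *)

Section VectorState.
Variables (R : realType) (c : nat).
Implicit Types (u v : l2 R) (S T P : op_cstar (l2_hilbert R)).

Fact delta_l2 : (fun m => (m == c)%:R : R[i]) \in @is_l2 R.
Proof.
apply/asboolP; exists 1 => n; rewrite /dot_sum.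
have [cn|nc] := ltnP c n.
  rewrite (bigD1 (Ordinal cn))//= eqxx big1 ?addr0.
    by rewrite /dotc /= mulr1 mulr0 addr0.
  by move=> i /negPf; rewrite -val_eqE /= => ->; exact: dotc0.
rewrite big1 ?ler01// => i _.
by rewrite (_ : (i == c :> nat) = false) ?dotc0// ltn_eqF//
  (leq_trans (ltn_ord i)).
Qed.

Definition delta : l2 R := L2 delta_l2.

Lemma deltaE m : delta m = (m == c)%:R. Proof. by []. Qed.

Lemma lrip_delta (z : R[i]) v : lrip (z *: delta) v = dotc z (v c).
Proof.
have E m : (z *: delta) m = if m == c then z else 0.
  by rewrite l2ZE deltaE; case: eqP; rewrite ?mulr1 ?mulr0.
apply: lrip_unique; apply: (@cvg_near_cst _ _ _ _ _).
exists c.+1 => // n cn'; have cn : (c < n)%N := cn'.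
rewrite /dot_sum (bigD1 (Ordinal cn)) // big1.
  by rewrite E eqxx [LHS]addr0.
by move=> i /negPf; rewrite -val_eqE E /= => ->; exact: dotc0.
Qed.

Definition vector_state T : R[i] := ((T : op _) delta : l2 R) c.

Lemma vector_stateD S T : vector_state (S + T) = vector_state S + vector_state
  T.
Proof. by []. Qed.

Lemma vector_stateZ (d : R[i]) T : vector_state (d *: T) = d * vector_state T.
Proof.
change ((opf ((d : R[i]) *: (T : op (l2_hilbert R))) delta : l2 R) c = d *
  vector_state T).
by rewrite opZE l2ZE.
Qed.

Lemma dotc_inj (z w : R[i]) : (forall d, dotc d z = dotc d w) -> z = w.
Proof.
move=> h; apply/eqP; rewrite eq_complex; apply/andP; split; apply/eqP.
  by have := h 1; rewrite /dotc /= !mul1r !mul0r !addr0.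
by have := h 'i; rewrite /dotc /= !mul1r !mul0r !add0r.
Qed.

Lemma rip_delta d v : @rip _ (l2_hilbert R) (d *: (delta : l2_hilbert R)) v =
  dotc d (v c).
Proof. exact: lrip_delta. Qed.

Lemma vector_state_adj T : vector_state (adj T) = Num.conj (vector_state T).
Proof.
apply: dotc_inj => d; rewrite -rip_delta -op_adjP op_Z ripJ ripC rip_delta.
rewrite /vector_state; case: d (_ c) => [a b] [e f]; rewrite /dotc /=; ring.
Qed.

(** The real inner products with delta and with its multiple by the imaginary
    unit are the real and the imaginary parts of a coordinate. *)
Lemma vector_state_ge0 T : 0 <= vector_state (adj T ** T).
Proof.
pose w := (T : op _) delta.
have h d : dotc d (vector_state (adj T ** T)) = rip (d *: w) w.
  by rewrite -rip_delta -op_adjP op_Z.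
have h1 := h 1; have h2 := h 'i.
rewrite scale1r in h1.
have i0 : rip ('i *: w) w = 0.
  have : rip ('i *: w) w = - rip ('i *: w) w.
    rewrite {1}ripJ (_ : Num.conj 'i = - 'i); last first.
      by apply/eqP; rewrite eq_complex /= oppr0 !eqxx.
    by rewrite scaleNr ripC ripNl.
  lra.
rewrite i0 in h2; rewrite lecE.
case: (vector_state _) h1 h2 => a b; rewrite /dotc /= !mul1r !mul0r addr0 add0r
  => -> ->.
by rewrite eqxx lrip_ge0.
Qed.

Lemma vector_stateM S P T :
  (forall u, (P : op _) u = (u : l2 R) c *: (delta : l2_hilbert R)) ->
  vector_state (S ** P ** T) = vector_state S * vector_state T.
Proof.
move=> hP.
rewrite /vector_state (_ : (S ** P ** T : op _) delta = (S : op _)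
  ((P : op _) ((T : op _) delta)))//.
by rewrite hP op_Z l2ZE mulrC.
Qed.
End VectorState.

(** * Purely infinite algebras of labeled spaces *)

Theorem proposition4p8 (R : realType) (G : labeled_graph)
    (D : cstar_algebra R) (s : letter G -> D) (p : set (vertex G) -> D)
    (hG : labeled_space G)
    (hmin : forall Q : set (vertex G) -> set (vertex G) -> Prop,
      quotient_labeled_space Q -> has_minimal_structure Q)
    (hD : universal_representation s p)
    (hpi : purely_infinite D) :
  strongly_disagreeable G.
Proof.
move=> H Hher Hsat l v l1 v1 nH0; apply: contrapT => ndis.
have Hmin := hmin _ (ideal_quotient hG Hher Hsat).
have [A [L [om [Am L0 omL omP]]]] := unique_word hG Hher Hsat Hmin l1 v1 nH0
  ndis.
have [x0 [x0c x00 x0P]] := isolated_point hG Hher Hsat Hmin Am L0 omL omP.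
have [srep _ univ] := hD; have [hA _ _] := Am.
have [f [[fD fZ fM fA] _ fp]] := univ _ _ _
  (orbit_representation R hG Hher x0c).
have pA : f (p A) = orbit_proj R x0 A by exact: fp.
have rank1 u : (orbit_proj R x0 A : op _) u =
    (u : l2 R) (code x0 x0) *: (delta R (code x0 x0) : l2_hilbert R).
  apply: l2_eq => m; rewrite l2ZE deltaE.
  have [[y oy <-]|nc] := code_case x0 m; last first.
    rewrite (proj_val0 _ _ nc); case: eqP => [e|]; last by rewrite mulr0.
    by case: (nc x0) => //; exact: orbit_base.
  rewrite proj_val//; case: asboolP => [yA|yA].
    have -> : y = x0.
      apply: x0P; first exact: (orbit_coherent hG Hher x0c).
        by apply: (prime_filter_minimal Am) => //;
          exact: (orbit_filter hG Hher x0c).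
      exact: orbit_lag.
    by rewrite eqxx mulr1.
  case: eqP => [e|]; last by rewrite mulr0.
  case: yA; rewrite (code_inj oy (orbit_base x0) e) x00.
  exact: filter_of_self.
apply: (@rank_one_not_purely_infinite R D
  (fun x => vector_state (code x0 x0) (f x)) (p A)) => //.
split.
- by move=> x y; rewrite fD vector_stateD.
- by move=> c x; rewrite fZ vector_stateZ.
- by move=> x; rewrite fA vector_state_adj.
- by move=> x; rewrite fM fA vector_state_ge0.
- exact: (rep_proj srep).
- by rewrite pA /vector_state rank1 l2ZE deltaE eqxx mulr1.
- by move=> x y; rewrite !fM; apply: vector_stateM => u; rewrite pA.
Qed.
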